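(* Let $n,m,l\in\mathbb{N}$, let $\Phi:\mathbb{M}_n\to\mathbb{M}_l$ and $\Psi:\mathbb{M}_m\to\mathbb{M}_l$ be strictly positive linear maps, let $f$ be a non-decreasing function on $(0,\infty)$ and $-1<p\le0$, and assume that $x\mapsto f(x^{1+p})$ is convex on $(0,\infty)$. Consider $$F_1(A,B):=\mathrm{Tr}\, f\bigl(\Phi(A^p)^{1/2}\Psi(B^q)\Phi(A^p)^{1/2}\bigr),\qquad F_2(A,B):=\mathrm{Tr}\, f\bigl((\Phi(A^{-p})^{1/2}\Psi(B^{-q})\Phi(A^{-p})^{1/2})^{-1}\bigr)$$ for $(A,B)\in\mathbb{P}_n\times\mathbb{P}_m$, where $q\in\mathbb{R}$ with $(p,q)\ne(0,0)$. Then: (1) For every $q\in[-1,0]\cup[1,2]$, $F_1$ is jointly convex. (2) For every $q\in[-1,0]$, $F_2$ is jointly convex. (3) If $m=l$ and $\Psi=\mathrm{id}$, then $F_2$ is jointly convex for every $q\in[1,2]$.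
   Context: $\mathbb{M}_n$: $n\times n$ complex matrices; $\mathbb{P}_n$: positive definite ones; $\mathrm{Tr}$: usual trace. A linear map is strictly positive if it maps positive definite matrices to positive definite matrices. *)

(* Defs.v *)
From HB Require Import structures.
From mathcomp Require Import all_boot all_order all_algebra.
From mathcomp Require Import complex.
From mathcomp Require Import reals exp.
Set Implicit Arguments. Unset Strict Implicit. Unset Printing Implicit Defensive.
Import Order.TTheory GRing.Theory Num.Theory.
Local Open Scope ring_scope.

Section MatrixDefs.
Context {R : realType}.
Local Notation C := R[i].

Definition adjmx p q (M : 'M[C]_(p, q)) : 'M[C]_(q, p) := (map_mx Num.conj M)^T.

Definition posdef n (A : 'M[C]_n) : Prop :=
  adjmx A = A /\ forall x : 'cV[C]_n, x != 0 -> 0 < (adjmx x *m A *m x) 0 0.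

Definition strictly_positive n l (Phi : 'M[C]_n -> 'M[C]_l) : Prop :=
  forall A, posdef A -> posdef (Phi A).

(* functional calculus for (Hermitian) matrices:
   A = U^-1 diag(lambda) U  ==>  g(A) = U^-1 diag(g(lambda)) U *)
Definition mxfun n (g : R -> R) (A : 'M[C]_n) : 'M[C]_n :=
  invmx (spectralmx A)
  *m diag_mx (map_mx (fun z : C => ((g (complex.Re z))%:C)%C) (spectral_diag A))
  *m spectralmx A.

Definition mxpow n (A : 'M[C]_n) (r : R) : 'M[C]_n := mxfun (fun x => x `^ r) A.
Definition mxsqrt n (A : 'M[C]_n) : 'M[C]_n := mxfun (@Num.sqrt R) A.

Definition F1 n m l (Phi : 'M[C]_n -> 'M[C]_l) (Psi : 'M[C]_m -> 'M[C]_l)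
  (f : R -> R) (p q : R) (A : 'M[C]_n) (B : 'M[C]_m) : R :=
  let P := mxsqrt (Phi (mxpow A p)) in
  complex.Re (\tr (mxfun f (P *m Psi (mxpow B q) *m P))).

Definition F2 n m l (Phi : 'M[C]_n -> 'M[C]_l) (Psi : 'M[C]_m -> 'M[C]_l)
  (f : R -> R) (p q : R) (A : 'M[C]_n) (B : 'M[C]_m) : R :=
  let P := mxsqrt (Phi (mxpow A (- p))) in
  complex.Re (\tr (mxfun f (invmx (P *m Psi (mxpow B (- q)) *m P)))).

Definition jointly_convex n m (F : 'M[C]_n -> 'M[C]_m -> R) : Prop :=
  forall (A1 A2 : 'M[C]_n) (B1 B2 : 'M[C]_m) (t : R),
    posdef A1 -> posdef A2 -> posdef B1 -> posdef B2 -> 0 <= t <= 1 ->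
    F ((t%:C)%C *: A1 + ((1 - t)%:C)%C *: A2) ((t%:C)%C *: B1 + ((1 - t)%:C)%C *: B2)
      <= t * F A1 B1 + (1 - t) * F A2 B2.

End MatrixDefs.

Definition nondecreasing_pos {R : realType} (g : R -> R) : Prop :=
  forall x y : R, 0 < x -> x <= y -> g x <= g y.

Definition convex_pos {R : realType} (g : R -> R) : Prop :=
  forall (x y t : R), 0 < x -> 0 < y -> 0 <= t <= 1 ->
    g (t * x + (1 - t) * y) <= t * g x + (1 - t) * g y.

(* Main.v *)
(** Put [c = - p] and [s = 1 / (1 - c)].  Since [y |-> f (y `^ (1 - c))] is convex
    and nondecreasing, weak majorization reduces the theorem to the joint convexity
    of the Ky Fan sums of [X `^ s], where [X = P^(1/2) Q P^(1/2)].  The sum of the [k]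
    largest eigenvalues of [X `^ s] is the maximum over [l x k] matrices [Z] of
    [s Tr (Z^* Q Z) - (s - 1) Tr (Z^* P^-1 Z)^(1/c)].  Here [Q] is operator convex in [B],
    so everything rests on the concavity of [A |-> Tr (Z^* P^-1 Z)^(1/c)].

    When [P^-1 = Phi (A^c)], write [Tr M^(1/c)] as the maximum over [S] of
    [Tr M S^(1-c) / c - (1/c - 1) Tr S]; it remains to prove Lieb's concavity of
    [(A, S) |-> Tr Phi (A^c) S^(1-c)] for a map [Phi] that is only positive.  For
    [A = \sum_j t_j A_j] and [S = \sum_j t_j S_j] the three lines theorem is applied to
    the pairing of [A^((c-z)/2) A_j^z A^((c-z)/2)] with
    [S^((z-c)/2) S_j^(1-z) S^((z-c)/2)], summed over [j]; on each edge of the strip one of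
    the two arguments is a congruence of a unitary matrix, and diagonalising that
    unitary matrix only involves positivity of [Phi].

    When [P = Phi (A^-c)], Choi's inequality dominates [P^-1] by the image of [A^c] under
    a positive map, with equality at any prescribed point, and this reduces to the
    first case. *)
Require Import Defs.
From HB Require Import structures.
From mathcomp Require Import all_boot all_order all_algebra.
From mathcomp Require Import perm spectral complex.
From mathcomp Require Import boolp classical_sets reals topology normedtype.
From mathcomp Require Import sequences derive realfun exp trigo.
From mathcomp Require Import ring lra.
Set Implicit Arguments. Unset Strict Implicit. Unset Printing Implicit Defensive.
Import Order.TTheory GRing.Theory Num.Theory.
Import numFieldNormedType.Exports.
Local Open Scope ring_scope.

(** * Harmonic functions on a strip *)

(** Both variational formulas are Young's inequality: [s] and [1 / c] are conjugate exponents
    because [1 / s + c = 1]. It is applied to pairs of eigenvalues and averaged with the squared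
    moduli of the entries of a unitary or isometric matrix. Compressing by [Z] separates [P] from
    [Q], hence [A] from [B]; the trace power then carries the negative coefficient [- (s - 1)],
    which is why concavity is what it must satisfy. The obstacle is that positivity of [Phi] is only
    usable on pairs of rank-one matrices, so tensor product proofs of Lieb's theorem do not apply.
    Interpolating all [j] together is essential: the edge bound for one [j] contains [A_j]
    conjugated by an imaginary power of [A], and only the sum [\sum_j t_j A_j = A] commutes with
    that power. One-sided bounds on real parts suffice, so the three lines theorem becomes a maximum
    principle for bounded harmonic functions. Entries of complex matrix powers are exponential
    polynomials, for which elementary estimates replace complex analysis. At [c = 0] the exponent
    [1 / c] is meaningless; there [P] does not depend on [A], and the linear form of Ky Fan's
    principle is enough. *)

Lemma derive0_linear_approx (R : realType) (f : R -> R) (c : R) :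
  is_derive (0 : R) 1 f c -> f 0 = 0 -> forall e : R, 0 < e ->
  exists2 d : R, 0 < d & forall x, `|x| < d -> `|f x - c * x| <= e * `|x|.
Proof.
move=> [df <-] f0 e e0; have /cvgrPdist_le/(_ e e0) := df.
rewrite /prop_near1 /= => -[d /= d0 Hd]; exists d => // x xd.
have [->|x0] := eqVneq x 0; first by rewrite f0 mulr0 subr0 normr0 mulr0.
have := Hd x; rewrite /= sub0r normrN => /(_ xd x0).
rewrite -[lim _]/('D_1 f 0) addr0 f0 subr0 [_%:A]mulr1 => H.
have -> : f x - 'D_1 f 0 * x = - ('D_1 f 0 - x^-1 * f x) * x by field.
by rewrite normrM normrN; apply: ler_wpM2r.
Qed.

Lemma expR_sub1_small (R : realType) (e : R) : 0 < e ->
  exists2 d : R, 0 < d & forall h, `|h| < d -> `|expR h - 1| <= e.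
Proof.
move=> e0; have /cvgrPdist_le/(_ e e0) := @continuous_expR R 0.
rewrite expR0 => -[d /= d0 Hd]; exists d => // h hd.
by rewrite distrC; apply: Hd; rewrite /= sub0r normrN.
Qed.

(* The error of the four-point mean value formula for the complex exponential: the
   second-order terms of [cosh] and [cos] cancel. *)
Lemma cosh_cos_small (R : realType) (e : R) : 0 < e ->
  exists2 d : R, 0 < d & forall h, `|h| < d ->
    `|expR h + expR (- h) + cos h *+ 2 - 4| <= e * h ^+ 2.
Proof.
move=> e0.
pose E (x : R) := expR x - expR (- x).
have dE : is_derive (0 : R) 1 E 2.
  by apply: is_derive_eq; rewrite oppr0 expR0; lra.
have dS : is_derive (0 : R) 1 (@sin R) 1.
  by have := is_derive_sin (0 : R); rewrite cos0.
(* The two factors below are at most [3 * e1 * |x|] and, since [e1 <= 1], [7 * |x|]. Their product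
   [21 * e1 * x ^+ 2] has to stay below [e * h ^+ 2 = 4 * e * x ^+ 2]. *)
pose e1 := Num.min 1 (e / 6).
have e10 : 0 < e1 by rewrite lt_min ltr01 divr_gt0.
have e11 : e1 <= 1 by rewrite ge_min lexx.
have e12 : e1 <= e / 6 by rewrite ge_min lexx orbT.
have E0 : E 0 = 0 by rewrite /E oppr0 subrr.
have [d1 d10 H1] := derive0_linear_approx dE E0 e10.
have [d2 d20 H2] := derive0_linear_approx dS (sin0 R) e10.
exists (Num.min d1 d2); first by rewrite lt_min d10.
move=> h; rewrite lt_min => /andP[h1 h2].
pose x := h / 2.
have hx : h = x *+ 2 by rewrite /x; field.
have xh : `|x| <= `|h|.
  by rewrite /x normrM ler_piMr// normfV normr_nat; lra.
(* Half-angle formulas give a difference of two squares of functions with derivative 2 at 0, so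
   first-order information about each is enough. *)
have -> : expR h + expR (- h) + cos h *+ 2 - 4 = E x ^+ 2 - (sin x *+ 2) ^+ 2.
  have -> : expR h = expR x ^+ 2 by rewrite hx expr2 -expRD mulr2n.
  have -> : expR (- h) = expR (- x) ^+ 2 by rewrite hx expr2 -expRD mulr2n opprD.
  rewrite {1}hx cos_mulr2n cos2sin2 /E.
  have := expRxMexpNx_1 x; set a := expR x; set b := expR (- x) => ab.
  have -> : (a - b) ^+ 2 = a ^+2 + b ^+ 2 - (a * b) *+ 2 by ring.
  by rewrite ab; ring.
have /ler_normlP[A1 A2] := H1 _ (le_lt_trans xh h1).
have /ler_normlP[B1 B2] := H2 _ (le_lt_trans xh h2).
have -> : E x ^+ 2 - (sin x *+ 2) ^+ 2 =
   ((E x - 2 * x) - (sin x - 1 * x) *+ 2) *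
    ((E x - 2 * x) + (sin x - 1 * x) *+ 2 + 4 * x) by ring.
set a := E x - 2 * x in A1 A2 *; set b := sin x - 1 * x in B1 B2 *.
rewrite normrM.
have x0 := normr_ge0 x.
have N1 : `|a - b *+ 2| <= 3 * e1 * `|x|.
  by rewrite ler_norml; apply/andP; split; lra.
have N2 : `|a + b *+ 2 + 4 * x| <= 7 * `|x|.
  have K : e1 * `|x| <= `|x| by rewrite ler_piMl.
  have /andP[X1 X2] : - `|x| <= x <= `|x| by rewrite -ler_norml.
  by rewrite ler_norml; apply/andP; split; lra.
apply: le_trans (ler_pM (normr_ge0 _) (normr_ge0 _) N1 N2) _.
have -> : 3 * e1 * `|x| * (7 * `|x|) = 21 * e1 * (`|x| ^+ 2) by ring.
rewrite real_normK ?num_real// hx.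
have -> : e * (x *+ 2) ^+ 2 = 4 * e * x ^+ 2 by ring.
have := sqr_ge0 x; nra.
Qed.

Section ThreeLines.
Context {R : realType}.
Implicit Types (u v : R -> R -> R) (e d h x y K : R).

(* An asymptotic substitute for harmonicity: the four-point mean value defect is
   uniformly o(h^2) on the strip. *)
Definition strip_harmonic u : Prop :=
  [/\ exists B, forall x y, 0 <= x <= 1 -> `|u x y| <= B,
      forall e, 0 < e -> exists2 d, 0 < d & forall h x y, 0 < h < d ->
        0 <= x <= 1 -> `|u (x + h) y + u (x - h) y + u x (y + h) + u x (y - h)
                          - 4 * u x y| <= e * h ^+ 2
    & forall e, 0 < e -> exists2 d, 0 < d & forall x x' y, 0 <= x <= 1 ->
        0 <= x' <= 1 -> `|x - x'| < d -> `|u x y - u x' y| <= e].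

Lemma strip_harmonicD u v : strip_harmonic u -> strip_harmonic v ->
  strip_harmonic (fun x y => u x y + v x y).
Proof.
move=> [[B1 b1] m1 c1] [[B2 b2] m2 c2]; split.
- exists (B1 + B2) => x y xI; apply: le_trans (ler_normD _ _) _.
  by apply: lerD; [exact: b1|exact: b2].
- move=> e e0; have e20 : 0 < e / 2 by rewrite divr_gt0.
  have [d1 d10 H1] := m1 _ e20; have [d2 d20 H2] := m2 _ e20.
  exists (Num.min d1 d2); first by rewrite lt_min d10.
  move=> h x y; rewrite lt_min => /andP[h0 /andP[hd1 hd2]] xI.
  have A1 := H1 h x y; rewrite h0 hd1 in A1; have {}A1 := A1 isT xI.
  have A2 := H2 h x y; rewrite h0 hd2 in A2; have {}A2 := A2 isT xI.
  have -> : e * h ^+ 2 = e / 2 * h ^+ 2 + e / 2 * h ^+ 2 by field.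
  apply: le_trans (lerD A1 A2); apply: le_trans (ler_normD _ _).
  by rewrite le_eqVlt; apply/orP; left; apply/eqP; congr `|_|; ring.
- move=> e e0; have e20 : 0 < e / 2 by rewrite divr_gt0.
  have [d1 d10 H1] := c1 _ e20; have [d2 d20 H2] := c2 _ e20.
  exists (Num.min d1 d2); first by rewrite lt_min d10.
  move=> x x' y xI x'I; rewrite lt_min => /andP[hd1 hd2].
  have A1 := H1 x x' y xI x'I hd1; have A2 := H2 x x' y xI x'I hd2.
  have -> : e = e / 2 + e / 2 by field.
  apply: le_trans (lerD A1 A2); apply: le_trans (ler_normD _ _).
  by rewrite le_eqVlt; apply/orP; left; apply/eqP; congr `|_|; ring.
Qed.

(** This is the real part of [(a + i b) * exp (k * (x + i y))]. By the addition formulas its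
    four-point defect is exactly its value at the centre times the defect estimated in
    [cosh_cos_small] at [k * h]. *)
Lemma strip_harmonic_exp (a b k : R) :
  strip_harmonic (fun x y => expR (k * x) * (a * cos (k * y) - b * sin (k * y))).
Proof.
pose T y := a * cos (k * y) - b * sin (k * y).
pose N := `|a| + `|b| + 1; pose M := expR `|k|.
have N0 : 0 < N by rewrite /N; have := normr_ge0 a; have := normr_ge0 b; lra.
have M0 : 0 < M by exact: expR_gt0.
have TN y : `|T y| <= N.
  apply: le_trans (ler_normB _ _) _; rewrite !normrM /N.
  have A : `|a| * `|cos (k * y)| <= `|a| by rewrite ler_piMr// cos_max.
  have B : `|b| * `|sin (k * y)| <= `|b| by rewrite ler_piMr// sin_max.
  by lra.
have EM x : 0 <= x <= 1 -> expR (k * x) <= M.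
  move=> /andP[x0 x1]; rewrite ler_expR; apply: le_trans (ler_norm _) _.
  by rewrite normrM ler_piMr// ger0_norm.
have k10 : 0 < `|k| + 1 by have := normr_ge0 k; lra.
split.
- exists (M * N) => x y xI; rewrite normrM ger0_norm ?expR_ge0//.
  by apply: ler_pM; rewrite ?expR_ge0 ?EM ?TN.
- move=> e e0.
  (* [M * N] bounds the function on the strip; using [|k| + 1] instead of [|k|] keeps every division
     legitimate when [k = 0]. *)
  pose e1 := e / (M * N * (`|k| + 1) ^+ 2).
  have e10 : 0 < e1 by rewrite divr_gt0// !mulr_gt0// exprn_gt0.
  have [d1 d10 H1] := cosh_cos_small e10.
  exists (d1 / (`|k| + 1)); first by rewrite divr_gt0.
  move=> h x y /andP[h0 hd] xI; rewrite -/(T y) -/(T (y + h)) -/(T (y - h)).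
  have kh : `|k * h| < d1.
    rewrite normrM (gtr0_norm h0); move: hd; rewrite ltr_pdivlMr// => hd.
    by apply: le_lt_trans hd; nra.
  have {H1} := H1 _ kh; set D := (_ - 4) => HD.
  have -> : expR (k * (x + h)) * T y + expR (k * (x - h)) * T y +
     expR (k * x) * T (y + h) + expR (k * x) * T (y - h) -
     4 * (expR (k * x) * T y) = expR (k * x) * T y * D.
    rewrite /T /D !mulrDr !mulrN expRD expRB cosD cosB sinD sinB expRN.
    by ring.
  rewrite 2!normrM (ger0_norm (expR_ge0 _)).
  have -> : e * h ^+ 2 = M * N * (e1 * ((`|k| + 1) * h) ^+ 2).
    by rewrite /e1; field; rewrite !gt_eqF.
  apply: ler_pM => //; first by rewrite mulr_ge0 ?expR_ge0.
    by apply: ler_pM; rewrite ?expR_ge0 ?EM ?TN.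
  apply: le_trans HD _; rewrite ler_pM2l// !exprMn ler_wpM2r ?sqr_ge0//.
  by rewrite -(real_normK (num_real k)); have := normr_ge0 k; nra.
- move=> e e0; pose e1 := e / (M * N).
  have e10 : 0 < e1 by rewrite divr_gt0// mulr_gt0.
  have [d1 d10 H1] := expR_sub1_small e10.
  exists (d1 / (`|k| + 1)); first by rewrite divr_gt0.
  move=> x x' y xI x'I; rewrite ltr_pdivlMr// => xx'; rewrite -/(T y).
  have kh : `|k * (x - x')| < d1.
    by rewrite normrM; apply: le_lt_trans xx'; have := normr_ge0 (x - x'); nra.
  have -> : expR (k * x) * T y - expR (k * x') * T y =
      expR (k * x') * T y * (expR (k * (x - x')) - 1).
    have -> : k * x = k * x' + k * (x - x') by ring.
    by rewrite expRD; ring.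
  rewrite 2!normrM (ger0_norm (expR_ge0 _)).
  have -> : e = M * N * e1 by rewrite /e1; field; rewrite !gt_eqF.
  apply: ler_pM => //; first by rewrite mulr_ge0 ?expR_ge0.
    by apply: ler_pM; rewrite ?expR_ge0 ?EM ?TN.
  exact: H1.
Qed.

(** Maximum principle on an unbounded strip. The supremum need not be attained, so the argument runs
    at a point that almost reaches it, for a perturbation of [u] that is strictly subharmonic. *)
Lemma strip_harmonic_le u K : strip_harmonic u ->
  (forall y, u 0 y <= K) -> (forall y, u 1 y <= K) ->
  forall x y, 0 <= x <= 1 -> u x y <= K.
Proof.
move=> [[B uB] um uc] u0 u1 x y xI.
apply/ler_addgt0Pr => e e0; have e20 : 0 < e / 2 by rewrite divr_gt0.
(* The term [- e / 2 * (x * (1 - x))] contributes exactly [e * h ^+ 2] to the four-point defect,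
   more than the [e / 2 * h ^+ 2] by which [u] may fail to be harmonic. *)
pose v x y := u x y - e / 2 * (x * (1 - x)).
suff H : forall x y, 0 <= x <= 1 -> v x y <= K + e / 2.
  have := H x y xI; rewrite /v.
  have : e / 2 * (x * (1 - x)) <= e / 2.
    by case/andP: xI => *; nra.
  by lra.
pose E : set R := fun r => exists x y, 0 <= x <= 1 /\ r = v x y.
have E0 : has_sup E.
  split; first by exists (v 0 0), 0, 0; rewrite lexx ler01.
  exists B => _ [a [b [aI ->]]]; rewrite /v.
  have := ler_norm (u a b); have := uB a b aI.
  have : 0 <= e / 2 * (a * (1 - a)) by case/andP: aI => *; rewrite !mulr_ge0//; lra.
  by lra.
have vS a b : 0 <= a <= 1 -> v a b <= sup E.
  by move=> aI; apply: sup_upper_bound => //; exists a, b.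
suff SK : sup E <= K + e / 2 by move=> a b aI; apply: le_trans SK; exact: vS.
have [d1 d10 H1] := um _ e20; have e40 : 0 < e / 4 by rewrite divr_gt0.
have [d2 d20 H2] := uc _ e40.
pose h := Num.min (1 / 4) (Num.min d1 d2) / 2.
have hd : Num.min (1 / 4) (Num.min d1 d2) = h * 2 by rewrite /h; field.
have h0 : 0 < h by rewrite divr_gt0// !lt_min d10 d20 divr_gt0.
have [h3 h1 h2] : [/\ h < 1 / 4, h < d1 & h < d2].
  have : h < Num.min (1 / 4) (Num.min d1 d2) by rewrite hd; lra.
  by rewrite !lt_min => /and3P.
(* [g <= e / 8 * h ^+ 2] makes [4 * g] at most the remaining defect [e / 2 * h ^+ 2], a
   contradiction at interior points. [g <= e / 4] serves points closer than [h] to an edge, where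
   uniform continuity in [x] costs another [e / 4]. *)
pose g := Num.min (e / 8 * h ^+ 2) (e / 4).
have g0 : 0 < g by rewrite lt_min e40 mulr_gt0 ?exprn_gt0// divr_gt0.
have [g1 g2] : g <= e / 8 * h ^+ 2 /\ g <= e / 4.
  by split; rewrite ge_min lexx ?orbT.
have [_ [a [b [aI ->]]] Hab] := sup_adherent g0 E0.
have vu : v a b <= u a b.
  by rewrite /v; case/andP: aI => *; rewrite gerBl !mulr_ge0//; lra.
have [ah|ah] := ltP a h.
  have := H2 a 0 b aI; rewrite lexx ler01 subr0 ger0_norm; last by case/andP: aI.
  move=> /(_ isT (lt_trans ah h2)) /(le_trans (ler_norm _)).
  by have := u0 b; lra.
have [ah'|ah'] := ltP (1 - h) a.
  have := H2 a 1 b aI; rewrite lexx ler01 distrC ger0_norm; last by case/andP: aI; lra.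
  have ad : 1 - a < d2 by lra.
  move=> /(_ isT ad) /(le_trans (ler_norm _)).
  by have := u1 b; lra.
have := H1 h a b; rewrite h0 h1 => /(_ isT aI) /ler_normlP[+ _].
have V1 : v (a + h) b <= sup E by apply: vS; apply/andP; split; lra.
have V2 : v (a - h) b <= sup E by apply: vS; apply/andP; split; lra.
have V3 := vS a (b + h) aI; have V4 := vS a (b - h) aI.
rewrite /v in V1 V2 V3 V4 Hab.
move=> HH; exfalso.
have := lerD (lerD V1 V2) (lerD V3 V4).
have := sqr_ge0 h; nra.
Qed.

End ThreeLines.

(** * The three lines theorem for exponential polynomials *)

Section ComplexExp.
Context {R : realType}.
Local Notation C := R[i].
Local Notation "x %:C" := (real_complex R x) (format "x %:C") : ring_scope.
Implicit Types (z w : C) (f g : C -> C).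

Definition cexp z : C :=
  ((expR (complex.Re z) * cos (complex.Im z)) +i*
   (expR (complex.Re z) * sin (complex.Im z)))%C.

Lemma cexpD z w : cexp (z + w) = cexp z * cexp w.
Proof.
case: z w => [a b] [c d]; apply/eqP; rewrite eq_complex /= expRD cosD sinD.
by apply/andP; split; apply/eqP; ring.
Qed.

Lemma cexp0 : cexp 0 = 1.
Proof. by rewrite /cexp /= expR0 cos0 sin0 mulr1 mulr0. Qed.

Lemma cexp_real (x : R) : cexp x%:C = (expR x)%:C.
Proof. by rewrite /cexp /= cos0 sin0 mulr1 mulr0. Qed.

Lemma cexp_conj z : (cexp z)^*%C = cexp (z^*%C).
Proof. by case: z => a b; rewrite /cexp /= cosN sinN mulrN. Qed.

(** The frequencies are real, being logarithms of eigenvalues in the applications; this makes the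
    functions bounded on vertical strips. *)
Definition exp_poly f : Prop :=
  exists s : seq (C * R), forall z, f z = \sum_(t <- s) t.1 * cexp (z * t.2%:C).

Lemma exp_poly_eq f g : f =1 g -> exp_poly f -> exp_poly g.
Proof. by move=> fg [s Hs]; exists s => z; rewrite -fg. Qed.

Lemma exp_polyD f g : exp_poly f -> exp_poly g -> exp_poly (fun z => f z + g z).
Proof.
by move=> [s Hs] [t Ht]; exists (s ++ t) => z; rewrite big_cat/= Hs Ht.
Qed.

Lemma exp_polyM f g : exp_poly f -> exp_poly g -> exp_poly (fun z => f z * g z).
Proof.
move=> [s Hs] [t Ht].
exists [seq (a.1 * b.1, a.2 + b.2) | a <- s, b <- t] => z.
rewrite big_allpairs_dep Hs Ht mulr_suml; apply: eq_bigr => a _.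
rewrite mulr_sumr; apply: eq_bigr => b _ /=.
by rewrite raddfD mulrDr cexpD; ring.
Qed.

Lemma exp_poly_cst c : exp_poly (fun=> c).
Proof. by exists [:: (c, 0)] => z; rewrite big_seq1 /= mulr0 cexp0 mulr1. Qed.

Lemma exp_poly_sum (I : Type) (s : seq I) (P : pred I) (F : I -> C -> C) :
  (forall i, exp_poly (F i)) -> exp_poly (fun z => \sum_(i <- s | P i) F i z).
Proof.
move=> HF; elim: s => [|i s IH].
  by apply: exp_poly_eq (exp_poly_cst 0) => z; rewrite big_nil.
have [Pi|Pi] := boolP (P i); last first.
  by apply: exp_poly_eq IH => z; rewrite big_cons (negbTE Pi).
by apply: exp_poly_eq (exp_polyD (HF i) IH) => z; rewrite big_cons Pi.
Qed.

Lemma exp_poly_cexp (a b k : R) :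
  exp_poly (fun z => cexp ((a%:C + b%:C * z) * k%:C)).
Proof.
exists [:: (cexp (a%:C * k%:C), b * k)] => z; rewrite big_seq1 /= -cexpD.
by congr cexp; rewrite rmorphM/=; ring.
Qed.

(** The hypothesis and conclusion are linear in [f]: no modulus and no logarithmic convexity occur,
    and the real part of each exponential term is strip harmonic. *)
Theorem three_lines f (K : R) : exp_poly f ->
  (forall y, complex.Re (f (0 +i* y)%C) <= K) ->
  (forall y, complex.Re (f (1 +i* y)%C) <= K) ->
  forall x : R, 0 <= x <= 1 -> complex.Re (f x%:C) <= K.
Proof.
move=> [s Hs] f0 f1 x xI.
pose u (t : seq (C * R)) (x y : R) :=
  complex.Re (\sum_(c <- t) c.1 * cexp ((x +i* y)%C * c.2%:C)).
suff su : strip_harmonic (u s).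
  have := @strip_harmonic_le _ (u s) K su _ _ x 0 xI.
  rewrite /u -Hs; apply=> y; rewrite -Hs; [exact: f0|exact: f1].
elim: s {Hs} => [|[c k] s IH].
  have := @strip_harmonic_exp R 0 0 0; congr strip_harmonic.
  by apply/funext => a; apply/funext => b; rewrite /u big_nil/=; ring.
have := strip_harmonicD (strip_harmonic_exp (complex.Re c) (complex.Im c) k) IH.
congr strip_harmonic.
apply/funext => a; apply/funext => b; rewrite /u big_cons raddfD /=; congr (_ + _).
by case: c => c1 c2; rewrite /cexp /= !mulr0 subr0 add0r ![_ * k]mulrC; ring.
Qed.

End ComplexExp.

(** * Functional calculus of Hermitian matrices *)

Section FunctionalCalculus.
Context {R : realType}.
Local Notation C := R[i].
Local Notation "x %:C" := (real_complex R x) (format "x %:C") : ring_scope.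

Lemma adjmxK m n : cancel (@adjmx R m n) (@adjmx R n m).
Proof. by move=> A; apply/matrixP => i j; rewrite !mxE conjCK. Qed.

Lemma adjmxE m n (A : 'M[C]_(m, n)) : adjmx A = map_mx Num.conj (A^T).
Proof. by rewrite /adjmx map_trmx. Qed.

Lemma adjmxM m n p (A : 'M[C]_(m, n)) (B : 'M[C]_(n, p)) :
  adjmx (A *m B) = adjmx B *m adjmx A.
Proof. by rewrite /adjmx map_mxM trmx_mul. Qed.

Lemma adjmxD m n (A B : 'M[C]_(m, n)) : adjmx (A + B) = adjmx A + adjmx B.
Proof. by apply/matrixP => i j; rewrite !mxE rmorphD. Qed.

Lemma adjmxZ m n c (A : 'M[C]_(m, n)) : adjmx (c *: A) = c^* *: adjmx A.
Proof. by apply/matrixP => i j; rewrite !mxE rmorphM. Qed.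

Lemma adjmxN m n (A : 'M[C]_(m, n)) : adjmx (- A) = - adjmx A.
Proof. by apply/matrixP => i j; rewrite !mxE rmorphN. Qed.

Lemma adjmx1 n : adjmx 1%:M = 1%:M :> 'M[C]_n.
Proof. by apply/matrixP => i j; rewrite !mxE eq_sym; case: eqP; rewrite ?rmorph1 ?rmorph0. Qed.

Lemma adjmx_inv n (A : 'M[C]_n) : adjmx (invmx A) = invmx (adjmx A).
Proof. by rewrite /adjmx map_invmx trmx_inv. Qed.

Definition qf n (A : 'M[C]_n) (x : 'cV[C]_n) : C := (adjmx x *m A *m x) 0 0.

Lemma qfD n (A B : 'M[C]_n) x : qf (A + B) x = qf A x + qf B x.
Proof. by rewrite /qf mulmxDr mulmxDl mxE. Qed.

Lemma qfZ n c (A : 'M[C]_n) x : qf (c *: A) x = c * qf A x.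
Proof. by rewrite /qf -scalemxAr -scalemxAl mxE. Qed.

Lemma qf_conj m n (A : 'M[C]_n) (Z : 'M[C]_(n, m)) x :
  qf (adjmx Z *m A *m Z) x = qf A (Z *m x).
Proof. by rewrite /qf adjmxM !mulmxA. Qed.

Lemma qf_adj n (A : 'M[C]_n) x : qf (adjmx A) x = (qf A x)^*.
Proof.
have -> : (qf A x)^* = (adjmx (adjmx x *m A *m x)) 0 0 by rewrite [RHS]mxE [RHS]mxE.
by rewrite !adjmxM adjmxK mulmxA.
Qed.

Definition psd n (A : 'M[C]_n) : Prop := forall x, 0 <= qf A x.

Lemma psd_adj n m (F : 'M[C]_(n, m)) : psd (F *m adjmx F).
Proof.
move=> x; rewrite /qf mulmxA -mulmxA.
have -> : adjmx F *m x = adjmx (adjmx x *m F) by rewrite adjmxM adjmxK.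
by rewrite mxE; apply: sumr_ge0 => i _; rewrite !mxE mul_conjC_ge0.
Qed.

Lemma posdef_psd n (A : 'M[C]_n) : posdef A -> psd A.
Proof.
move=> [_ HA] x; have [->|x0] := eqVneq x 0; last by apply/ltW/HA.
by rewrite /qf mulmx0 mxE.
Qed.

Lemma posdef_congr m n (A : 'M[C]_n) (Z : 'M[C]_(n, m)) : posdef A ->
  (forall x : 'cV_m, Z *m x = 0 -> x = 0) -> posdef (adjmx Z *m A *m Z).
Proof.
move=> [Ah Ap] Zi; split; first by rewrite !adjmxM adjmxK Ah mulmxA.
move=> x x0; rewrite -/(qf _ x) qf_conj; apply: Ap; apply: contra_neq x0; exact: Zi.
Qed.

Lemma posdefD n (A B : 'M[C]_n) : posdef A -> posdef B -> posdef (A + B).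
Proof.
move=> [Ah Ap] [Bh Bp]; split; first by rewrite adjmxD Ah Bh.
by move=> x x0; rewrite -/(qf _ x) qfD addr_gt0// ?Ap ?Bp.
Qed.

Lemma conjC_real (x : R) : (x%:C)^* = x%:C.
Proof. by apply/eqP; rewrite eq_complex /= oppr0 !eqxx. Qed.

Lemma posdefZ n (A : 'M[C]_n) (c : R) : 0 < c -> posdef A -> posdef (c%:C *: A).
Proof.
move=> c0 [Ah Ap]; split; first by rewrite adjmxZ Ah conjC_real.
by move=> x x0; rewrite -/(qf _ x) qfZ mulr_gt0// ?Ap// ltcR.
Qed.

Lemma posdef_convex n (A B : 'M[C]_n) (t : R) : 0 <= t <= 1 ->
  posdef A -> posdef B -> posdef (t%:C *: A + (1 - t)%:C *: B).
Proof.
case/andP; rewrite le_eqVlt => /predU1P[<-|t0].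
  by rewrite subr0 scale0r add0r scale1r.
rewrite le_eqVlt => /predU1P[->|t1] A0 B0.
  by rewrite subrr scale0r addr0 scale1r.
by apply: posdefD; apply: posdefZ => //; rewrite subr_gt0.
Qed.

Lemma posdef_unit n (A : 'M[C]_n) : posdef A -> A \in unitmx.
Proof.
move=> [Ah Ap]; rewrite -unitmx_tr -row_free_unit -kermx_eq0.
apply/rowV0P => v /sub_kermxP vA; apply/eqP; apply: contraTT isT => v0.
have x0 : v^T != 0 by apply: contra_neq v0 => /(congr1 trmx); rewrite trmxK trmx0.
have := Ap _ x0; rewrite -mulmxA.
have -> : A *m v^T = 0 by rewrite -[A]trmxK -trmx_mul vA trmx0.
by rewrite mulmx0 mxE ltxx.
Qed.

Lemma posdef_inv n (A : 'M[C]_n) : posdef A -> posdef (invmx A).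
Proof.
move=> A0; have Au := posdef_unit A0; have [Ah _] := A0.
have -> : invmx A = adjmx (invmx A) *m A *m invmx A.
  by rewrite -mulmxA mulmxV// mulmx1 adjmx_inv Ah.
by apply: posdef_congr => // x Ax; rewrite -[x](mulKVmx Au) Ax mulmx0.
Qed.

Definition unitary n (U : 'M[C]_n) : Prop := U *m adjmx U = 1%:M.

Lemma unitary_adjl n (U : 'M[C]_n) : unitary U -> adjmx U *m U = 1%:M.
Proof. by move=> /mulmx1C. Qed.

Lemma unitary_adj n (U : 'M[C]_n) : unitary U -> unitary (adjmx U).
Proof. by rewrite /unitary adjmxK; apply: unitary_adjl. Qed.

Lemma unitaryM n (U V : 'M[C]_n) : unitary U -> unitary V -> unitary (U *m V).
Proof. by rewrite /unitary adjmxM mulmxA => UU VV; rewrite -(mulmxA U) VV mulmx1. Qed.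

(** The unitary matrix is arbitrary, unlike in [mxfun], which is tied to the chosen [spectralmx];
    diagonalisations built by hand can thus be used directly. *)
Definition spec n (U : 'M[C]_n) (d : 'I_n -> C) : 'M[C]_n :=
  adjmx U *m diag_mx (\row_i d i) *m U.

Lemma eq_spec n (U : 'M[C]_n) d e : d =1 e -> spec U d = spec U e.
Proof. by move=> de; congr (_ *m diag_mx _ *m _); apply/rowP => i; rewrite !mxE de. Qed.

Lemma specM n (U : 'M[C]_n) d e : unitary U ->
  spec U d *m spec U e = spec U (fun i => d i * e i).
Proof.
move=> UU; rewrite /spec !mulmxA -(mulmxA _ U) UU mulmx1 -(mulmxA _ (diag_mx _) (diag_mx _)).
rewrite mulmx_diag; congr (_ *m diag_mx _ *m _).
by apply/rowP => i; rewrite !mxE.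
Qed.

Lemma spec_adj n (U : 'M[C]_n) d : adjmx (spec U d) = spec U (fun i => (d i)^*).
Proof.
rewrite /spec !adjmxM adjmxK mulmxA; congr (_ *m _ *m _).
by apply/matrixP => i j; rewrite !mxE eq_sym rmorphMn/=; case: eqP => [->|].
Qed.

Lemma spec_cst n (U : 'M[C]_n) c : unitary U -> spec U (fun=> c) = c%:M.
Proof.
move=> UU; rewrite /spec.
have -> : diag_mx (\row_(i < n) c) = c%:M by apply/matrixP => i j; rewrite !mxE.
by rewrite mul_mx_scalar -scalemxAl unitary_adjl// scalemx1.
Qed.

Lemma spec_tr n (U : 'M[C]_n) d : unitary U -> \tr (spec U d) = \sum_i d i.
Proof.
move=> UU; rewrite /spec mxtrace_mulC mulmxA UU mul1mx mxtrace_diag.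
by apply: eq_bigr => i _; rewrite mxE.
Qed.

Lemma spec_qf n (U : 'M[C]_n) d x :
  qf (spec U d) x = \sum_i d i * `|(U *m x) i 0| ^+ 2.
Proof.
rewrite /spec qf_conj /qf mul_mx_diag mxE; apply: eq_bigr => i _.
by rewrite !mxE normCK mulrAC mulrC [_^* * _]mulrC.
Qed.

Lemma spec_inv n (U : 'M[C]_n) d : unitary U -> (forall i, d i != 0) ->
  invmx (spec U d) = spec U (fun i => (d i)^-1).
Proof.
move=> UU d0; have H : spec U d *m spec U (fun i => (d i)^-1) = 1%:M.
  by rewrite specM// -(spec_cst 1 UU); apply: eq_spec => i; rewrite divff.
by rewrite -[RHS]mul1mx -(mulVmx (mulmx1_unit H).1) -mulmxA H mulmx1.
Qed.

(** [T = V *m adjmx U] intertwines the two diagonal matrices, so [d j = e i] wherever [T i j] is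
    nonzero, and then [h (d j) = h (e i)] as well. *)
Lemma spec_fun n (U V : 'M[C]_n) d e (h : C -> C) : unitary U -> unitary V ->
  spec U d = spec V e -> spec U (h \o d) = spec V (h \o e).
Proof.
move=> UU VV E; pose T := V *m adjmx U.
have sandwich (c1 c2 : 'I_n -> C) : (spec U c1 = spec V c2) <->
    T *m diag_mx (\row_i c1 i) = diag_mx (\row_i c2 i) *m T.
  split=> H.
    have := congr1 (fun M => V *m M *m adjmx U) H; rewrite /spec /T.
    by rewrite !mulmxA VV mul1mx -!mulmxA UU mulmx1 !mulmxA.
  have := congr1 (fun M => adjmx V *m M *m U) H; rewrite /spec /T.
  by rewrite !mulmxA unitary_adjl// mul1mx -!mulmxA unitary_adjl// mulmx1 !mulmxA.
apply/sandwich; have /sandwich/matrixP H := E; clearbody T.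
apply/matrixP => i j; have := H i j.
rewrite !mul_mx_diag !mul_diag_mx !mxE /=.
have [->|T0] := eqVneq (T i j) 0; first by rewrite !mulr0 !mul0r.
by rewrite [RHS]mulrC => /(mulfI T0) ->; rewrite mulrC.
Qed.

Lemma spectralmx_unitary n (A : 'M[C]_n) : unitary (spectralmx A).
Proof.
by rewrite /unitary adjmxE; apply/unitarymxP/spectral_unitarymx.
Qed.

Lemma invmx_spectralmx n (A : 'M[C]_n) :
  invmx (spectralmx A) = adjmx (spectralmx A).
Proof. by rewrite invmx_unitary ?spectral_unitarymx// adjmxE. Qed.

Lemma normal_spec n (A : 'M[C]_n) : A *m adjmx A = adjmx A *m A ->
  A = spec (spectralmx A) (fun i => spectral_diag A 0 i).
Proof.
rewrite [in X in X -> _]adjmxE => /normalmxP/orthomx_spectralP{1}->.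
rewrite /spec invmx_spectralmx.
by congr (_ *m diag_mx _ *m _); apply/rowP => i; rewrite mxE.
Qed.

(** Functional calculus may be computed in any diagonalisation with real eigenvalues; the power laws
    below all reduce to scalar ones through this. *)
Lemma mxfun_spec n (U : 'M[C]_n) (g d : _ -> R) : unitary U ->
  mxfun g (spec U (fun i => (d i)%:C)) = spec U (fun i => (g (d i))%:C).
Proof.
move=> UU; set A := spec U _.
have AA : A *m adjmx A = adjmx A *m A.
  by rewrite spec_adj !specM//; apply: eq_spec => i; rewrite mulrC.
have := spec_fun (fun z => (g (complex.Re z))%:C) UU (spectralmx_unitary A) (normal_spec AA).
rewrite /comp /= => ->; rewrite /mxfun invmx_spectralmx /spec.
by congr (_ *m diag_mx _ *m _); apply/rowP => i; rewrite !mxE.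
Qed.

Lemma spec_inj n (U : 'M[C]_n) d e : unitary U -> spec U d = spec U e -> d =1 e.
Proof.
move=> UU /(congr1 (fun M => U *m M *m adjmx U)).
rewrite /spec !mulmxA UU mul1mx -!mulmxA UU !mulmx1 mul1mx => /matrixP H i.
by have := H i i; rewrite !mxE eqxx !mulr1n.
Qed.

Lemma herm_spectral n (A : 'M[C]_n) : adjmx A = A ->
  A = spec (spectralmx A) (fun i => (complex.Re (spectral_diag A 0 i))%:C).
Proof.
move=> Ah; have AA : A *m adjmx A = adjmx A *m A by rewrite Ah.
rewrite {1}(normal_spec AA); apply: eq_spec => i.
have : spec (spectralmx A) (fun i => (spectral_diag A 0 i)^*)
     = spec (spectralmx A) (fun i => spectral_diag A 0 i).
  by rewrite -spec_adj -(normal_spec AA).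
by move/(spec_inj (spectralmx_unitary A))/(_ i)/CrealP/RRe_real.
Qed.

Lemma posdef_spec_gt0 n (U : 'M[C]_n) (d : 'I_n -> R) : unitary U ->
  posdef (spec U (fun i => (d i)%:C)) -> forall i, 0 < d i.
Proof.
move=> UU [_ Ap] i.
pose x := adjmx U *m (delta_mx i 0 : 'cV[C]_n).
have Ux : U *m x = delta_mx i 0 by rewrite mulmxA UU mul1mx.
have x0 : x != 0.
  apply/eqP => x0; move: Ux; rewrite x0 mulmx0 => /matrixP/(_ i 0).
  by rewrite !mxE !eqxx => /esym/eqP; rewrite oner_eq0.
have := Ap _ x0; rewrite -/(qf _ x) spec_qf Ux (bigD1 i)//= big1 => [|j ji].
  by rewrite !mxE !eqxx normr1 expr1n mulr1 addr0 ltcR.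
by rewrite !mxE (negbTE ji) normr0 expr0n/= mulr0.
Qed.

Lemma posdef_spec n (A : 'M[C]_n) : posdef A -> exists U (d : 'I_n -> R),
  [/\ unitary U, forall i, 0 < d i & A = spec U (fun i => (d i)%:C)].
Proof.
move=> A0; have AE := herm_spectral A0.1; have UU := spectralmx_unitary A.
exists (spectralmx A), (fun i => complex.Re (spectral_diag A 0 i)); split=> //.
by apply: (posdef_spec_gt0 UU); rewrite -AE.
Qed.

Lemma spec_posdef n (U : 'M[C]_n) (d : 'I_n -> R) : unitary U ->
  (forall i, 0 < d i) -> posdef (spec U (fun i => (d i)%:C)).
Proof.
move=> UU d0; split.
  by rewrite spec_adj; apply: eq_spec => i; rewrite conjC_real.
move=> x x0; rewrite -/(qf _ x) spec_qf.
have nn i : 0 <= (d i)%:C * `|(U *m x) i 0| ^+ 2.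
  by rewrite mulr_ge0 ?exprn_ge0// lecR ltW.
rewrite lt_def sumr_ge0// andbT; apply: contra_neq x0 => /eqP.
rewrite psumr_eq0// => /allP H.
suff Ux : U *m x = 0 by rewrite -[x]mul1mx -(unitary_adjl UU) -mulmxA Ux mulmx0.
apply/matrixP => i j; rewrite ord1 [RHS]mxE; have := H i (mem_index_enum _).
rewrite /= mulf_eq0 expf_eq0 /= normr_eq0 => /orP[|/eqP//].
by rewrite -(rmorph0 (real_complex R)) (inj_eq (@complexI _)) gt_eqF.
Qed.

Lemma mxpow_spec n (U : 'M[C]_n) (d : 'I_n -> R) r : unitary U ->
  mxpow (spec U (fun i => (d i)%:C)) r = spec U (fun i => (d i `^ r)%:C).
Proof. exact: mxfun_spec. Qed.

Lemma mxpow_posdef n (A : 'M[C]_n) r : posdef A -> posdef (mxpow A r).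
Proof.
move=> /posdef_spec[U [d [UU d0 ->]]]; rewrite (mxpow_spec _ _ UU).
by apply: spec_posdef => // i; rewrite powR_gt0.
Qed.

Lemma mxpowD n (A : 'M[C]_n) r s : posdef A ->
  mxpow A (r + s) = mxpow A r *m mxpow A s.
Proof.
move=> /posdef_spec[U [d [UU d0 ->]]]; rewrite !(mxpow_spec _ _ UU) (specM _ _ UU).
by apply: eq_spec => i; rewrite -rmorphM powRD// (gt_eqF (d0 i)) implybT.
Qed.

Lemma mxpow0 n (A : 'M[C]_n) : posdef A -> mxpow A 0 = 1%:M.
Proof.
move=> /posdef_spec[U [d [UU d0 ->]]]; rewrite !(mxpow_spec _ _ UU) -(spec_cst 1 UU).
by apply: eq_spec => i; rewrite powRr0.
Qed.

Lemma mxpow1 n (A : 'M[C]_n) : posdef A -> mxpow A 1 = A.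
Proof.
move=> /posdef_spec[U [d [UU d0 ->]]]; rewrite !(mxpow_spec _ _ UU).
by apply: eq_spec => i; rewrite powRr1// ltW.
Qed.

Lemma mxpowM n (A : 'M[C]_n) r s : posdef A -> mxpow (mxpow A r) s = mxpow A (r * s).
Proof.
move=> /posdef_spec[U [d [UU d0 ->]]]; rewrite !(mxpow_spec _ _ UU).
by apply: eq_spec => i; rewrite powRrM.
Qed.

Lemma mxpowN n (A : 'M[C]_n) r : posdef A -> mxpow A (- r) = invmx (mxpow A r).
Proof.
move=> /posdef_spec[U [d [UU d0 ->]]]; rewrite !(mxpow_spec _ _ UU) (spec_inv UU) => [|i].
  by apply: eq_spec => i; rewrite powRN fmorphV.
by rewrite -(rmorph0 (real_complex R)) (inj_eq (@complexI _)) gt_eqF// powR_gt0.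
Qed.

Lemma mxsqrtE n (A : 'M[C]_n) : posdef A -> mxsqrt A = mxpow A (2^-1).
Proof.
move=> /posdef_spec[U [d [UU d0 ->]]]; rewrite (mxpow_spec _ _ UU) /mxsqrt (mxfun_spec _ _ UU).
by apply: eq_spec => i; rewrite powR12_sqrt// ltW.
Qed.

End FunctionalCalculus.

(** * Lieb concavity for positive bilinear forms *)

Section PositiveForms.
Context {R : realType}.
Local Notation C := R[i].
Local Notation "x %:C" := (real_complex R x) (format "x %:C") : ring_scope.

(** The matrix [exp (z log A)]. Every eigenvalue contributes an exponential in [z], so the group law
    and the unitarity of imaginary powers hold for all [A]; positive definiteness serves to identify
    real powers with [mxpow]. *)
Definition mxcpow n (A : 'M[C]_n) (z : C) : 'M[C]_n :=
  spec (spectralmx A)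
    (fun i => cexp (z * (ln (complex.Re (spectral_diag A 0 i)))%:C)).

Lemma mxcpowD n (A : 'M[C]_n) z w : mxcpow A (z + w) = mxcpow A z *m mxcpow A w.
Proof.
rewrite /mxcpow specM; last exact: spectralmx_unitary.
by apply: eq_spec => i; rewrite mulrDl cexpD.
Qed.

Lemma mxcpow0 n (A : 'M[C]_n) : mxcpow A 0 = 1%:M.
Proof.
rewrite /mxcpow -(spec_cst 1 (spectralmx_unitary A)).
by apply: eq_spec => i; rewrite mul0r cexp0.
Qed.

Lemma mxcpow_adj n (A : 'M[C]_n) z : adjmx (mxcpow A z) = mxcpow A (z^*).
Proof.
rewrite /mxcpow spec_adj; apply: eq_spec => i.
by rewrite [LHS]cexp_conj; congr cexp; rewrite -[LHS]/((_ * _)^*) rmorphM/= conjC_real.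
Qed.

Lemma mxcpow_real n (A : 'M[C]_n) (x : R) : posdef A -> mxcpow A x%:C = mxpow A x.
Proof.
move=> A0; have AE := herm_spectral A0.1; have UU := spectralmx_unitary A.
rewrite {2}AE (mxpow_spec _ _ UU); apply: eq_spec => i.
have := A0; rewrite {1}AE => /(posdef_spec_gt0 UU)/(_ i) d0.
by rewrite -rmorphM/= cexp_real /powR gt_eqF.
Qed.

Lemma mxcpow_unitary n (A : 'M[C]_n) (y : R) : unitary (mxcpow A (0 +i* y)%C).
Proof.
rewrite /unitary mxcpow_adj -mxcpowD -(mxcpow0 A); congr mxcpow.
by apply/eqP; rewrite eq_complex /= addr0 subrr !eqxx.
Qed.

Lemma mxcpow_exp_poly n (A : 'M[C]_n) (a b : R) i j :
  exp_poly (fun z => mxcpow A (a%:C + b%:C * z) i j).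
Proof.
pose U := spectralmx A; pose d i := complex.Re (spectral_diag A 0 i).
apply: (@exp_poly_eq _ (fun z => \sum_k (adjmx U i k * U k j) *
    cexp ((a%:C + b%:C * z) * (ln (d k))%:C))) => [z|].
  rewrite /mxcpow /spec [RHS]mxE; apply: eq_bigr => k _.
  by rewrite mul_mx_diag [X in _ = X * _]mxE [(\row_ _ _) _ _]mxE mulrAC.
apply: exp_poly_sum => k; apply: exp_polyM; first exact: exp_poly_cst.
exact: exp_poly_cexp.
Qed.

Definition mexp_poly m n (F : C -> 'M[C]_(m, n)) := forall i j, exp_poly (fun z => F z i j).

Lemma mexp_polyM m n p (F : C -> 'M[C]_(m, n)) (G : C -> 'M[C]_(n, p)) :
  mexp_poly F -> mexp_poly G -> mexp_poly (fun z => F z *m G z).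
Proof.
move=> HF HG i j; apply: (@exp_poly_eq _ (fun z => \sum_k F z i k * G z k j)).
  by move=> z; rewrite mxE.
by apply: exp_poly_sum => k; apply: exp_polyM; [exact: HF|exact: HG].
Qed.

(* A bilinear form [w X Y = \tr (Phi X *m Y)] is of this kind as soon as [Phi] is
   positive; complete positivity is not required. *)
Definition pos_bilin n k (w : 'M[C]_n -> 'M[C]_k -> C) : Prop :=
  [/\ forall a X X' Y, w (a *: X + X') Y = a * w X Y + w X' Y,
      forall a X Y Y', w X (a *: Y + Y') = a * w X Y + w X Y'
    & forall (x : 'cV_n) (y : 'cV_k), 0 <= w (x *m adjmx x) (y *m adjmx y)].

Lemma pos_bilin_flip n k (w : 'M[C]_n -> 'M[C]_k -> C) :
  pos_bilin w -> pos_bilin (fun Y X => w X Y).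
Proof. by case=> w1 w2 w3; split=> *; rewrite ?w1 ?w2//; apply: w3. Qed.

Lemma pos_bilin_congr n k n' k' (w : 'M[C]_n -> 'M[C]_k -> C)
    (D : 'M[C]_(n, n')) (E : 'M[C]_(k, k')) : pos_bilin w ->
  pos_bilin (fun X Y => w (D *m X *m adjmx D) (E *m Y *m adjmx E)).
Proof.
case=> w1 w2 w3; split=> [a X X' Y|a X Y Y'|x y].
- by rewrite mulmxDr mulmxDl -scalemxAr -scalemxAl w1.
- by rewrite mulmxDr mulmxDl -scalemxAr -scalemxAl w2.
- have -> : D *m (x *m adjmx x) *m adjmx D = (D *m x) *m adjmx (D *m x).
    by rewrite adjmxM !mulmxA.
  have -> : E *m (y *m adjmx y) *m adjmx E = (E *m y) *m adjmx (E *m y).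
    by rewrite adjmxM !mulmxA.
  exact: w3.
Qed.

Section Form.
Variables (n k : nat) (w : 'M[C]_n -> 'M[C]_k -> C).
Hypothesis Hw : pos_bilin w.

Lemma pformDl X X' Y : w (X + X') Y = w X Y + w X' Y.
Proof. by case: Hw => w1 _ _; rewrite -{1}[X]scale1r w1 mul1r. Qed.

Lemma pform0l Y : w 0 Y = 0.
Proof. by apply: (addrI (w 0 Y)); rewrite -pformDl !addr0. Qed.

Lemma pformZl a X Y : w (a *: X) Y = a * w X Y.
Proof. by case: Hw => w1 _ _; rewrite -[a *: X]addr0 w1 pform0l addr0. Qed.

Lemma pform_suml (I : Type) (s : seq I) (F : I -> 'M[C]_n) Y :
  w (\sum_(i <- s) F i) Y = \sum_(i <- s) w (F i) Y.
Proof.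
by elim: s => [|i s IH]; rewrite ?big_nil ?pform0l// !big_cons pformDl IH.
Qed.

Lemma pform_adj_ge0 m (F : 'M[C]_(n, m)) (y : 'cV_k) :
  0 <= w (F *m adjmx F) (y *m adjmx y).
Proof.
have -> : F *m adjmx F = \sum_j (col j F *m adjmx (col j F)).
  apply/matrixP => a b; rewrite summxE [LHS]mxE; apply: eq_bigr => j _.
  by rewrite [RHS]mxE big_ord1 !mxE.
rewrite pform_suml; apply: sumr_ge0 => j _; by case: Hw => _ _ ->.
Qed.

(** Polarisation: the form is real at [c *: F + G], and comparing imaginary parts for [c = 1] and
    [c = 'i] gives the two real equations. *)
Lemma pform_conj m (F G : 'M[C]_(n, m)) (y : 'cV_k) :
  w (G *m adjmx F) (y *m adjmx y) = (w (F *m adjmx G) (y *m adjmx y))^*.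
Proof.
set Y := y *m _.
have E (c : C) : w ((c *: F + G) *m adjmx (c *: F + G)) Y =
   c * c^* * w (F *m adjmx F) Y + c * w (F *m adjmx G) Y
   + c^* * w (G *m adjmx F) Y + w (G *m adjmx G) Y.
  rewrite adjmxD adjmxZ mulmxDr !mulmxDl -!scalemxAr -!scalemxAl.
  by rewrite !pformDl !pformZl; ring.
have Ege c : complex.Im (c * c^* * w (F *m adjmx F) Y + c * w (F *m adjmx G) Y
   + c^* * w (G *m adjmx F) Y + w (G *m adjmx G) Y) = 0.
  by rewrite -E; exact: ger0_Im (pform_adj_ge0 _ y).
have H1 := Ege 1; have Hi := Ege 'i%C.
have HF := ger0_Im (pform_adj_ge0 F y); have HG := ger0_Im (pform_adj_ge0 G y).
move: H1 Hi HF HG; rewrite -/Y {E Ege}.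
case: (w (F *m adjmx F) Y) => f1 f2; case: (w (G *m adjmx G) Y) => g1 g2.
case: (w (F *m adjmx G) Y) => a b; case: (w (G *m adjmx F) Y) => c d /=.
move=> H1 Hi HF HG; apply/eqP; rewrite eq_complex /=; apply/andP; split; apply/eqP; lra.
Qed.

End Form.

End PositiveForms.

(** * Positive bilinear forms at a unitary argument *)

Section UnitaryBound.
Context {R : realType}.
Local Notation C := R[i].
Local Notation "x %:C" := (real_complex R x) (format "x %:C") : ring_scope.

Lemma spec_sum n (U : 'M[C]_n) d :
  spec U d = \sum_b d b *: (col b (adjmx U) *m adjmx (col b (adjmx U))).
Proof.
apply/matrixP => i j; rewrite summxE /spec [LHS]mxE; apply: eq_bigr => b _.
rewrite mul_mx_diag [X in X * _ = _]mxE [(\row_ _ _) _ _]mxE [RHS]mxE [in RHS]mxE.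
by rewrite big_ord1 !mxE conjCK; ring.
Qed.

Section Form.
Variables (n k : nat) (w : 'M[C]_n -> 'M[C]_k -> C).
Hypothesis Hw : pos_bilin w.

Lemma pform_exp_poly F G : mexp_poly F -> mexp_poly G ->
  exp_poly (fun z => w (F z) (G z)).
Proof.
move=> HF HG; have Hf := pos_bilin_flip Hw.
apply: (@exp_poly_eq _ (fun z => \sum_i \sum_j (F z i j * \sum_a \sum_b (G z a b *
   w (delta_mx i j) (delta_mx a b))))) => [z|].
  rewrite {2}(matrix_sum_delta (F z)) (pform_suml Hw); apply: eq_bigr => i _.
  rewrite (pform_suml Hw); apply: eq_bigr => j _; rewrite (pformZl Hw); congr (_ * _).
  rewrite {2}(matrix_sum_delta (G z)) (pform_suml Hf); apply: eq_bigr => a _.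
  by rewrite (pform_suml Hf); apply: eq_bigr => b _; rewrite (pformZl Hf).
apply: exp_poly_sum => i; apply: exp_poly_sum => j; apply: exp_polyM; first exact: HF.
apply: exp_poly_sum => a; apply: exp_poly_sum => b; apply: exp_polyM; first exact: HG.
exact: exp_poly_cst.
Qed.

(* Diagonalising [U] reduces this to positive functionals of [X], for
   which it is the Cauchy-Schwarz inequality applied to [u F - G] with [|u| = 1]. *)
Lemma pform_unitary_le m (F G : 'M[C]_(n, m)) U : unitary U ->
  complex.Re (w (F *m adjmx G) U) *+ 2 <=
  complex.Re (w (F *m adjmx F) 1%:M + w (G *m adjmx G) 1%:M).
Proof.
move=> UU; have Hf := pos_bilin_flip Hw.
have UN : U *m adjmx U = adjmx U *m U by rewrite UU unitary_adjl.
have UE := normal_spec UN; set Q := spectralmx U in UE.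
have QQ : unitary Q := spectralmx_unitary U.
set u := fun i => spectral_diag U 0 i in UE.
have u1 i : u i * (u i)^* = 1.
  apply: (spec_inj QQ (d := fun i => u i * (u i)^*) (e := fun=> 1)).
  by rewrite -specM// -spec_adj -UE UU spec_cst.
rewrite {1}UE -(spec_cst 1 QQ) !spec_sum.
rewrite !(pform_suml Hf) -big_split/= !raddf_sum/= -sumrMnl; apply: ler_sum => b _.
rewrite !(pformZl Hf) !mul1r; set y := col b _.
have := pform_adj_ge0 Hw (u b *: F - G) y.
have -> : (u b *: F - G) *m adjmx (u b *: F - G) = F *m adjmx F + G *m adjmx G
    + (- u b) *: (F *m adjmx G) + (- (u b)^*) *: (G *m adjmx F).
  rewrite adjmxD adjmxN adjmxZ mulmxDr !mulmxDl !mulmxN !mulNmx opprK.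
  rewrite -!scalemxAl -!scalemxAr scalerA u1 scale1r !scaleNr.
  have AC (V : zmodType) (p q r s : V) : p + q + (r + s) = p + s + r + q.
    by rewrite [r + s]addrC addrA (addrAC p) (addrAC _ q).
  exact: AC.
rewrite !(pformDl Hw) !(pformZl Hw) (pform_conj Hw F G) -/y.
rewrite lecE => /andP[_] /=.
set a := w (F *m adjmx G) _; rewrite !raddfD/=.
have -> : complex.Re (- (u b)^* * a^*) = complex.Re (- u b * a).
  by rewrite -rmorphN -rmorphM; case: (- u b * a).
have -> : complex.Re (- u b * a) = - complex.Re (u b * a) by rewrite mulNr raddfN.
by rewrite mulr2n; lra.
Qed.
End Form.

End UnitaryBound.

Local Opaque adjmx mxfun mxpow mxsqrt spec mxcpow.

(** * Interpolation and joint concavity *)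

Section LiebConcavity.
Context {R : realType}.
Local Notation C := R[i].
Local Notation "x %:C" := (real_complex R x) (format "x %:C") : ring_scope.

Lemma mxcpowC n (A : 'M[C]_n) z w :
  mxcpow A z *m mxcpow A w = mxcpow A w *m mxcpow A z.
Proof. by rewrite -!mxcpowD (addrC z w). Qed.

Lemma mxcpow_comm n (A : 'M[C]_n) z : posdef A -> mxcpow A z *m A = A *m mxcpow A z.
Proof.
move=> A0; have E : mxcpow A 1%:C = A := etrans (mxcpow_real 1 A0) (mxpow1 A0).
by have := mxcpowC A z 1%:C; rewrite E => ->.
Qed.

Lemma cRe_realM (r : R) (v : C) : complex.Re (r%:C * v) = r * complex.Re v.
Proof. by case: v => v1 v2 /=; rewrite mul0r subr0. Qed.

Lemma cRe_add (u v : C) : complex.Re (u + v) = complex.Re u + complex.Re v.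
Proof. by case: u v => [a b] [c d]. Qed.

(** The pairs [a, b] and [c, d] are the edge bounds for the two endpoints; both weighted sums equal
    the same [x], which absorbs the factor 2. *)
Lemma convex_Re_le (t : R) (u v x a b c d : C) : 0 <= t -> 0 <= 1 - t ->
  complex.Re u *+ 2 <= complex.Re (a + b) -> complex.Re v *+ 2 <= complex.Re (c + d) ->
  x = t%:C * a + (1 - t)%:C * c -> x = t%:C * b + (1 - t)%:C * d ->
  complex.Re (t%:C * u + (1 - t)%:C * v) <= complex.Re x.
Proof.
move=> t0 t1 E1 E2 /(congr1 (@complex.Re R)) G1 /(congr1 (@complex.Re R)) G2.
move: E1 E2 G1 G2; rewrite !cRe_add !cRe_realM !mulr2n.
move: (complex.Re u) (complex.Re v) (complex.Re x) (complex.Re a) (complex.Re b)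
  (complex.Re c) (complex.Re d) => {}u {}v {}x {}a {}b {}c {}d E1 E2 G1 G2.
by have := ler_wpM2l t0 E1; have := ler_wpM2l t1 E2; lra.
Qed.

Section Interpolation.
Variables (n k : nat) (w : 'M[C]_n -> 'M[C]_k -> C).
Hypothesis Hw : pos_bilin w.

(** At [z = c] the outer factors become the identity and leave the pairing to be estimated. Every
    exponent has the affine form [a + b * z], even when [a] or [b] is trivial, to match
    [mxcpow_exp_poly]. *)
Definition lieb_interp (c : R) (A A1 : 'M[C]_n) (S S1 : 'M[C]_k) (z : C) : C :=
  w (mxcpow A ((c / 2)%:C + (- 2^-1)%:C * z) *m mxcpow A1 (0%:C + 1%:C * z) *m
     mxcpow A ((c / 2)%:C + (- 2^-1)%:C * z))
    (mxcpow S ((- (c / 2))%:C + (2^-1)%:C * z) *m mxcpow S1 (1%:C + (-1)%:C * z) *m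
     mxcpow S ((- (c / 2))%:C + (2^-1)%:C * z)).

Lemma lieb_interp_exp_poly c A A1 S S1 : exp_poly (lieb_interp c A A1 S S1).
Proof.
by apply: pform_exp_poly => //; (apply: mexp_polyM; first apply: mexp_polyM);
  move=> i j; apply: mxcpow_exp_poly.
Qed.

Lemma lieb_interp_real c A A1 S S1 : posdef A -> posdef A1 -> posdef S -> posdef S1 ->
  lieb_interp c A A1 S S1 c%:C = w (mxpow A1 c) (mxpow S1 (1 - c)).
Proof.
move=> A0 A10 S0 S10; rewrite /lieb_interp.
have -> : (c / 2)%:C + (- 2^-1)%:C * c%:C = 0.
  by rewrite -rmorphM -rmorphD/= mulNr mulrC subrr.
have -> : (- (c / 2))%:C + (2^-1)%:C * c%:C = 0.
  by rewrite -rmorphM -rmorphD/= [2^-1 * _]mulrC addNr.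
have -> : 0%:C + 1%:C * c%:C = c%:C by rewrite rmorph0 add0r rmorph1 mul1r.
have -> : 1%:C + (-1)%:C * c%:C = (1 - c)%:C by rewrite rmorphN1 mulN1r -rmorphB.
by rewrite !mxcpow0 !mul1mx !mulmx1 !mxcpow_real.
Qed.

(** At [1 + i y] the second argument is [D *m (V1 *m V2 *m V1) *m D] with a unitary middle factor,
    so [S1] disappears from the bound. The core of the first argument is [W *m H *m V *m H *m W],
    split as [F *m adjmx G] with [F = W *m H *m V] and [G = adjmx W *m H]. The unitary [V] cancels
    in [F *m adjmx F], and both squares are conjugates of [A1]. *)
Lemma lieb_interp_edge c A A1 S S1 (y : R) : posdef A -> posdef A1 -> posdef S ->
  let W := mxcpow A (0 +i* (- (y / 2)))%C in
  let CA := mxpow A ((c - 1) / 2) in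
  complex.Re (lieb_interp c A A1 S S1 (1 +i* y)%C) *+ 2 <=
  complex.Re (w (CA *m (W *m A1 *m adjmx W) *m adjmx CA) (mxpow S (1 - c)) +
              w (CA *m (adjmx W *m A1 *m W) *m adjmx CA) (mxpow S (1 - c))).
Proof.
move=> A0 A10 S0; cbv zeta; set W := mxcpow A _; set CA := mxpow A _.
pose D := mxpow S ((1 - c) / 2).
pose H := mxcpow A1 (2^-1)%:C; pose V := mxcpow A1 (0 +i* y)%C.
pose V1 := mxcpow S (0 +i* (y / 2))%C; pose V2 := mxcpow S1 (0 +i* (- y))%C.
have UU : unitary (V1 *m V2 *m V1).
  by apply: unitaryM; [apply: unitaryM|]; apply: mxcpow_unitary.
have VV : unitary V by apply: mxcpow_unitary.
have Hh : adjmx H = H by rewrite mxcpow_adj conjC_real.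
have CAh : adjmx CA = CA by case: (mxpow_posdef ((c - 1) / 2) A0).
have Dh : adjmx D = D by case: (mxpow_posdef ((1 - c) / 2) S0).
have HH : H *m H = A1.
  rewrite /H mxcpow_real// -(mxpowD _ _ A10) -[RHS](mxpow1 A10).
  by congr (mxpow _ _); field.
have DD : D *m D = mxpow S (1 - c).
  by rewrite /D -(mxpowD _ _ S0); congr (mxpow _ _); field.
have CAE : CA = mxcpow A ((c - 1) / 2)%:C := esym (mxcpow_real _ A0).
have DE : D = mxcpow S ((1 - c) / 2)%:C := esym (mxcpow_real _ S0).
have XE : mxcpow A ((c / 2)%:C + (- 2^-1)%:C * (1 +i* y)%C) = CA *m W.
  rewrite CAE /W -mxcpowD; congr (mxcpow _ _); apply/eqP; rewrite eq_complex /=.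
  by apply/andP; split; apply/eqP; field.
have XE' : CA *m W = W *m CA by rewrite CAE; exact: mxcpowC.
have YE : mxcpow S ((- (c / 2))%:C + (2^-1)%:C * (1 +i* y)%C) = D *m V1.
  rewrite DE /V1 -mxcpowD; congr (mxcpow _ _); apply/eqP; rewrite eq_complex /=.
  by apply/andP; split; apply/eqP; field.
have YE' : D *m V1 = V1 *m D by rewrite DE; exact: mxcpowC.
have ME : mxcpow A1 (0%:C + 1%:C * (1 +i* y)%C) = H *m V *m H.
  rewrite /H /V -!mxcpowD; congr (mxcpow _ _); apply/eqP; rewrite eq_complex /=.
  by apply/andP; split; apply/eqP; field.
have NE : mxcpow S1 (1%:C + (-1)%:C * (1 +i* y)%C) = V2.
  congr (mxcpow _ _); apply/eqP; rewrite eq_complex /=.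
  by apply/andP; split; apply/eqP; ring.
rewrite /lieb_interp XE YE ME NE {2}XE' {2}YE' -DD.
move: VV Hh CAh Dh HH XE' YE' UU {CAE DE DD XE YE ME NE}.
move: CA W H V D V1 V2 => {}CA {}W {}H {}V {}D {}V1 {}V2 VV Hh CAh Dh HH XE YE UU.
have := pform_unitary_le (pos_bilin_congr CA D Hw) (W *m H *m V) (adjmx W *m H) UU.
rewrite !adjmxM !adjmxK Hh CAh Dh mulmx1.
have -> : W *m H *m V *m (adjmx V *m (H *m adjmx W)) = W *m A1 *m adjmx W.
  by rewrite -HH !mulmxA -(mulmxA _ V) VV mulmx1.
have -> : adjmx W *m H *m (H *m W) = adjmx W *m A1 *m W by rewrite -HH !mulmxA.
by rewrite !mulmxA.
Qed.

(** After weighting and summing, [A1] and [A2] combine to [A], which commutes with the unitary [W];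
    both conjugations become trivial, and the outer factors turn [A] into its power [c]. *)
Lemma lieb_interp_edge2 c (t : R) A A1 A2 S S1 S2 (y : R) :
  A = t%:C *: A1 + (1 - t)%:C *: A2 ->
  0 <= t <= 1 -> posdef A -> posdef A1 -> posdef A2 -> posdef S ->
  complex.Re (t%:C * lieb_interp c A A1 S S1 (1 +i* y)%C +
              (1 - t)%:C * lieb_interp c A A2 S S2 (1 +i* y)%C) <=
  complex.Re (w (mxpow A c) (mxpow S (1 - c))).
Proof.
move=> AE tI A0 A10 A20 S0.
have [t0 t1] : 0 <= t /\ 0 <= 1 - t by case/andP: tI => ? ?; split; lra.
have E1 := lieb_interp_edge c S1 y A0 A10 S0.
have E2 := lieb_interp_edge c S2 y A0 A20 S0.
have WW := mxcpow_unitary A (- (y / 2)).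
have WA := mxcpow_comm (0 +i* (- (y / 2)))%C A0.
have CAh : adjmx (mxpow A ((c - 1) / 2)) = mxpow A ((c - 1) / 2) := (mxpow_posdef _ A0).1.
have Ak : mxpow A ((c - 1) / 2) *m A *m adjmx (mxpow A ((c - 1) / 2)) = mxpow A c.
  rewrite CAh -[X in _ *m X *m _](mxpow1 A0) -!(mxpowD _ _ A0).
  by congr (mxpow _ _); field.
move: E1 E2 WW WA {CAh} Ak; cbv zeta.
move: (lieb_interp c A A1 S S1 (1 +i* y)%C) (lieb_interp c A A2 S S2 (1 +i* y)%C) => l1 l2.
move: (mxcpow A _) (mxpow A ((c - 1) / 2)) (mxpow A c) (mxpow S (1 - c)).
move=> W CA Ac Y E1 E2 WW WA Ak.
have WA' : adjmx W *m A *m W = A by rewrite -mulmxA -WA mulmxA unitary_adjl// mul1mx.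
have WA'' : W *m A *m adjmx W = A by rewrite WA -mulmxA WW mulmx1.
have G (Z Z' : 'M[C]_n) :
    w (CA *m (Z *m A *m Z') *m adjmx CA) Y = t%:C * w (CA *m (Z *m A1 *m Z') *m adjmx CA) Y
    + (1 - t)%:C * w (CA *m (Z *m A2 *m Z') *m adjmx CA) Y.
  rewrite -!(pformZl Hw) -(pformDl Hw) AE.
  rewrite (mulmxDr Z) (mulmxDl _ _ Z') (mulmxDr CA) (mulmxDl _ _ (adjmx CA)).
  by do 4![rewrite -?scalemxAr -?scalemxAl].
have G1 := G W (adjmx W); rewrite WA'' Ak in G1.
have G2 := G (adjmx W) W; rewrite WA' Ak in G2.
exact: (convex_Re_le t0 t1 E1 E2 G1 G2).
Qed.

End Interpolation.

Theorem lieb_pos_bilin n k (w : 'M[C]_n -> 'M[C]_k -> C) (c t : R) A1 A2 S1 S2 :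
  pos_bilin w -> 0 <= c <= 1 -> 0 <= t <= 1 ->
  posdef A1 -> posdef A2 -> posdef S1 -> posdef S2 ->
  t * complex.Re (w (mxpow A1 c) (mxpow S1 (1 - c))) +
  (1 - t) * complex.Re (w (mxpow A2 c) (mxpow S2 (1 - c))) <=
  complex.Re (w (mxpow (t%:C *: A1 + (1 - t)%:C *: A2) c)
                (mxpow (t%:C *: S1 + (1 - t)%:C *: S2) (1 - c))).
Proof.
move=> Hw cI tI A10 A20 S10 S20.
have := posdef_convex tI A10 A20; have := posdef_convex tI S10 S20.
move: (erefl (t%:C *: A1 + (1 - t)%:C *: A2)) (erefl (t%:C *: S1 + (1 - t)%:C *: S2)).
move: {1 3 4}(t%:C *: A1 + _) {1 3 4}(t%:C *: S1 + _) => A S AE SE S0 A0.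
pose phi z := t%:C * lieb_interp w c A A1 S S1 z + (1 - t)%:C * lieb_interp w c A A2 S S2 z.
have Ephi : exp_poly phi.
  by apply: exp_polyD; apply: exp_polyM; (exact: exp_poly_cst || exact: lieb_interp_exp_poly).
have := three_lines Ephi _ _ cI.
rewrite /phi !lieb_interp_real// cRe_add.
rewrite !cRe_realM; apply=> y; last exact: (lieb_interp_edge2 Hw c S1 S2 y AE tI A0 A10 A20 S0).
(* the substitution [z |-> 1 - z] exchanges the roles of the two variables *)
have := @lieb_interp_edge2 _ _ _ (pos_bilin_flip Hw) (1 - c) t S S1 S2 A A1 A2 (- y) SE tI S0 S10 S20 A0.
rewrite subKr => H.
have E B D : lieb_interp w c A B S D (0 +i* y)%C =
    lieb_interp (fun Y : 'M_k => w^~ Y) (1 - c) S D A B (1 +i* (- y))%C.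
  rewrite /lieb_interp.
  have -> : (c / 2)%:C + (- 2^-1)%:C * (0 +i* y)%C = (- ((1 - c) / 2))%:C + (2^-1)%:C * (1 +i* (- y))%C.
    by apply/eqP; rewrite eq_complex /=; apply/andP; split; apply/eqP; field.
  have -> : 0%:C + 1%:C * (0 +i* y)%C = 1%:C + (-1)%:C * (1 +i* (- y))%C.
    by apply/eqP; rewrite eq_complex /=; apply/andP; split; apply/eqP; field.
  have -> : (- (c / 2))%:C + (2^-1)%:C * (0 +i* y)%C = ((1 - c) / 2)%:C + (- 2^-1)%:C * (1 +i* (- y))%C.
    by apply/eqP; rewrite eq_complex /=; apply/andP; split; apply/eqP; field.
  have -> : 1%:C + (-1)%:C * (0 +i* y)%C = 0%:C + 1%:C * (1 +i* (- y))%C.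
    by apply/eqP; rewrite eq_complex /=; apply/andP; split; apply/eqP; field.
  reflexivity.
by rewrite -!E in H; exact: H.
Qed.

End LiebConcavity.

(** * Concavity of trace powers *)

Section TracePower.
Context {R : realType}.
Local Notation C := R[i].
Local Notation "x %:C" := (real_complex R x) (format "x %:C") : ring_scope.

Lemma tr_mul_spec n (N U : 'M[C]_n) d :
  \tr (N *m spec U d) = \sum_b d b * qf N (col b (adjmx U)).
Proof.
rewrite spec_sum mulmx_sumr raddf_sum/=; apply: eq_bigr => b _.
rewrite -scalemxAr mxtraceZ mulmxA mxtrace_mulC mulmxA /qf.
by rewrite trace_mx11.
Qed.

Lemma cRe_sum (I : Type) (r : seq I) (F : I -> C) :
  complex.Re (\sum_(i <- r) F i) = \sum_(i <- r) complex.Re (F i).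
Proof. by apply: (big_morph (@complex.Re R)) => // u v; apply: cRe_add. Qed.

Definition sqn (z : C) : R := complex.Re z ^+ 2 + complex.Im z ^+ 2.

Lemma sqnE z : (sqn z)%:C = `|z| ^+ 2.
Proof. exact: add_Re2_Im2. Qed.

Lemma sqn_ge0 z : 0 <= sqn z.
Proof. by rewrite addr_ge0// sqr_ge0. Qed.

Lemma unitary_row_sqn n (T : 'M[C]_n) i : unitary T -> \sum_j sqn (T i j) = 1.
Proof.
move=> /matrixP/(_ i i); rewrite !mxE eqxx => H; apply: (@complexI R).
rewrite rmorph_sum rmorph1 -[RHS]H /=; apply: eq_bigr => j _.
by rewrite [LHS]sqnE normCK !mxE.
Qed.

Lemma unitary_col_sqn n (T : 'M[C]_n) j : unitary T -> \sum_i sqn (T i j) = 1.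
Proof.
move=> /unitary_adj/unitary_row_sqn-/(_ j) <-; apply: eq_bigr => i _.
by rewrite !mxE /sqn; case: (T i j) => a b /=; rewrite sqrrN.
Qed.

(** The weights form a doubly stochastic matrix, so a trace inequality between two functions of
    matrices follows from a scalar inequality for each pair of eigenvalues. *)
Lemma tr_spec_spec n (U V : 'M[C]_n) (d e : 'I_n -> R) :
  complex.Re (\tr (spec U (fun i => (d i)%:C) *m spec V (fun i => (e i)%:C))) =
  \sum_j \sum_i sqn ((U *m adjmx V) i j) * (d i * e j).
Proof.
rewrite tr_mul_spec cRe_sum; apply: eq_bigr => j _.
rewrite spec_qf mulr_sumr cRe_sum; apply: eq_bigr => i _.
have -> : (U *m col j (adjmx V)) i 0 = (U *m adjmx V) i j by rewrite [RHS]mxE [LHS]mxE; apply: eq_bigr => l _; congr (_ * _); rewrite mxE.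
by rewrite -sqnE -!rmorphM /=; ring.
Qed.

(** Young's inequality for [m] and [s ^ (1 - c)] with exponents [1 / c] and [1 / (1 - c)],
    multiplied by [1 / c]. *)
Lemma young_pow (c m s : R) : 0 < c < 1 -> 0 < m -> 0 < s ->
  c^-1 * (m * s `^ (1 - c)) - (c^-1 - 1) * s <= m `^ (c^-1).
Proof.
move=> /andP[c0 c1] m0 s0.
have c10 : 0 < 1 - c by rewrite subr_gt0.
have := @conjugate_powR R m (s `^ (1 - c)) (c^-1) ((1 - c)^-1) (ltW m0) (powR_ge0 _ _).
rewrite !invr_gt0 c0 c10 !invrK addrC subrK => /(_ isT isT erefl).
rewrite -powRrM mulfV ?gt_eqF// powRr1 ?(ltW s0)// => H.
have ci0 : 0 <= c^-1 by rewrite invr_ge0 ltW.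
have := ler_wpM2l ci0 H.
have -> : c^-1 * (m `^ c^-1 * c + s * (1 - c)) = m `^ c^-1 + (c^-1 - 1) * s.
  by field; rewrite gt_eqF.
lra.
Qed.

Lemma tr_powR_ge k (M S : 'M[C]_k) (c : R) : 0 < c < 1 -> posdef M -> posdef S ->
  c^-1 * complex.Re (\tr (M *m mxpow S (1 - c))) - (c^-1 - 1) * complex.Re (\tr S) <=
  complex.Re (\tr (mxpow M (c^-1))).
Proof.
move=> cI /posdef_spec[U [m [UU m0 ->]]] /posdef_spec[V [s [VV s0 ->]]].
rewrite !mxpow_spec// tr_spec_spec !spec_tr// -!rmorph_sum/=.
have TT : unitary (U *m adjmx V) by apply: unitaryM => //; apply: unitary_adj.
have -> : \sum_i s i = \sum_j \sum_i sqn ((U *m adjmx V) i j) * s j.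
  by apply: eq_bigr => j _; rewrite -mulr_suml unitary_col_sqn// mul1r.
have -> : \sum_i m i `^ c^-1 = \sum_j \sum_i sqn ((U *m adjmx V) i j) * m i `^ c^-1.
  rewrite exchange_big/=; apply: eq_bigr => i _.
  by rewrite -mulr_suml unitary_row_sqn// mul1r.
rewrite !mulr_sumr -sumrB; apply: ler_sum => j _.
rewrite !mulr_sumr -sumrB; apply: ler_sum => i _.
have := ler_wpM2l (sqn_ge0 ((U *m adjmx V) i j)) (young_pow cI (m0 i) (s0 j)).
move: (sqn _) => q; apply: le_trans.
by rewrite le_eqVlt; apply/orP; left; apply/eqP; ring.
Qed.

(** The bound of [tr_powR_ge] is attained at [S = M ^ (1 / c)], because
    [1 + (1 - c) / c = 1 / c]. *)
Lemma tr_powR_max k (M : 'M[C]_k) (c : R) : 0 < c < 1 -> posdef M ->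
  complex.Re (\tr (mxpow M (c^-1))) =
  c^-1 * complex.Re (\tr (M *m mxpow (mxpow M (c^-1)) (1 - c)))
   - (c^-1 - 1) * complex.Re (\tr (mxpow M (c^-1))).
Proof.
move=> /andP[c0 _] M0; rewrite (mxpowM _ _ M0).
rewrite -[X in X *m _](mxpow1 M0) -(mxpowD _ _ M0).
have -> : 1 + c^-1 * (1 - c) = c^-1 by field; rewrite gt_eqF.
by ring.
Qed.

Lemma tr_mul_posdef_le k (M N S : 'M[C]_k) : (forall x, qf M x <= qf N x) -> posdef S ->
  complex.Re (\tr (M *m S)) <= complex.Re (\tr (N *m S)).
Proof.
move=> MN /posdef_spec[V [s [VV s0 ->]]]; rewrite !tr_mul_spec !cRe_sum.
apply: ler_sum => b _; rewrite !cRe_realM; apply: ler_wpM2l; first exact: ltW (s0 b).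
by have := MN (col b (adjmx V)); rewrite lecE => /andP[].
Qed.

(** The power [1 / c] exceeds 1 and need not preserve the operator order, but its trace is a maximum
    over [S] of functionals monotone in [M]. The optimal [S] for [M] is a trial matrix for [N]. *)
Lemma tr_powR_mono k (M N : 'M[C]_k) (c : R) : 0 < c < 1 -> posdef M -> posdef N ->
  (forall x, qf M x <= qf N x) ->
  complex.Re (\tr (mxpow M (c^-1))) <= complex.Re (\tr (mxpow N (c^-1))).
Proof.
move=> cI M0 N0 MN; have S0 := mxpow_posdef (c^-1) M0.
refine (le_trans _ (tr_powR_ge cI N0 S0)); rewrite [leLHS](tr_powR_max cI M0).
rewrite lerD2r ler_wpM2l//; first by rewrite invr_ge0; case/andP: cI => /ltW.
exact: tr_mul_posdef_le MN (mxpow_posdef _ S0).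
Qed.

(** Stated for plain functions so that it applies to maps assembled from congruences and other
    positive maps. *)
Definition posmap n k (P : 'M[C]_n -> 'M[C]_k) : Prop :=
  (forall a X Y, P (a *: X + Y) = a *: P X + P Y) /\ strictly_positive P.

Lemma posdef_scalar n (e : R) : 0 < e -> posdef (e%:C%:M : 'M[C]_n).
Proof.
move=> e0; have U1 : unitary (1%:M : 'M[C]_n) by rewrite /unitary adjmx1 mulmx1.
by rewrite -(spec_cst e%:C U1); apply: spec_posdef.
Qed.

(** Strict positivity speaks only of definite matrices; semidefinite ones are reached as limits of
    [e *: 1 + X]. *)
Lemma posmap_psd n k (P : 'M[C]_n -> 'M[C]_k) (X : 'M[C]_n) :
  posmap P -> adjmx X = X -> psd X -> psd (P X).
Proof.
move=> [Pl Pp] Xh Xp y.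
have X0 e : 0 < e -> posdef (e%:C *: 1%:M + X).
  move=> e0; have [Ih Ip] := posdef_scalar n e0; rewrite scalemx1; split.
    by rewrite adjmxD Ih Xh.
  move=> v v0; rewrite -/(qf _ v) qfD ltr_pwDl//; exact: Ip.
have H e : 0 < e -> 0 <= e%:C * qf (P 1%:M) y + qf (P X) y.
  by move=> e0; rewrite -qfZ -qfD -Pl; apply/posdef_psd/Pp/X0.
have I0 : 0 <= qf (P 1%:M) y.
  by apply/posdef_psd/Pp; rewrite -(rmorph1 (real_complex R)); apply: posdef_scalar.
move: H I0; case: (qf (P X) y) => a b; case: (qf (P 1%:M) y) => c d H.
rewrite lecE /= => /andP[/eqP d0 c0]; rewrite lecE /=.
have := H 1 ltr01; rewrite lecE /= mul1r d0 mulr0 !mul0r !addr0 add0r.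
move=> /andP[-> _] /=; apply/ler_addgt0Pr => e e0; rewrite addrC.
(* Here [c], the value of the form of [P 1] at [y], may vanish; adding 1 keeps the quotient
   meaningful and its product with [c] at most [e]. *)
have e1 : 0 < e / (c + 1) by rewrite divr_gt0// ltr_wpDl.
have := H _ e1; rewrite lecE /= !mul0r subr0 => /andP[_ /le_trans]; apply.
rewrite lerD2r mulrAC -mulrA ler_piMr// ?(ltW e0)//.
by rewrite ler_pdivrMr; lra.
Qed.

Lemma posmap_bilin n k (P : 'M[C]_n -> 'M[C]_k) : posmap P ->
  pos_bilin (fun X Y => \tr (P X *m Y)).
Proof.
move=> HP; have [Pl _] := HP; split.
- by move=> a X X' Y; rewrite Pl mulmxDl -scalemxAl mxtraceD mxtraceZ.
- by move=> a X Y Y'; rewrite mulmxDr -scalemxAr mxtraceD mxtraceZ.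
- move=> x y; rewrite mulmxA mxtrace_mulC mulmxA trace_mx11.
  by apply: (posmap_psd HP); [rewrite adjmxM adjmxK|exact: psd_adj].
Qed.

Lemma weighted_comb_le (a t m1 m2 m x1 x2 x s : R) : 0 <= a ->
  s = t * m1 + (1 - t) * m2 ->
  m1 = a * x1 - (a - 1) * m1 -> m2 = a * x2 - (a - 1) * m2 ->
  a * x - (a - 1) * s <= m -> t * x1 + (1 - t) * x2 <= x ->
  t * m1 + (1 - t) * m2 <= m.
Proof.
move=> a0 -> E1 E2 /(le_trans _) + H; apply; rewrite {1}E1 {1}E2.
by have := ler_wpM2l a0 H; lra.
Qed.

Theorem tr_powR_concave n k (P : 'M[C]_n -> 'M[C]_k) (c t : R) A1 A2 :
  posmap P -> 0 < c < 1 -> 0 <= t <= 1 -> posdef A1 -> posdef A2 ->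
  t * complex.Re (\tr (mxpow (P (mxpow A1 c)) c^-1)) +
  (1 - t) * complex.Re (\tr (mxpow (P (mxpow A2 c)) c^-1)) <=
  complex.Re (\tr (mxpow (P (mxpow (t%:C *: A1 + (1 - t)%:C *: A2) c)) c^-1)).
Proof.
move=> HP cI tI A10 A20; have A0 := posdef_convex tI A10 A20.
have [_ Pp] := HP.
have M10 := Pp _ (mxpow_posdef c A10); have M20 := Pp _ (mxpow_posdef c A20).
have M0 := Pp _ (mxpow_posdef c A0).
have S10 := mxpow_posdef c^-1 M10; have S20 := mxpow_posdef c^-1 M20.
(* The convex combination of the two optimal matrices is the trial matrix at the combined point;
   joint concavity then compares the values. *)
have S0 := posdef_convex tI S10 S20.
have cI' : 0 <= c <= 1 by case/andP: cI => /ltW -> /ltW ->.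
have L := lieb_pos_bilin (posmap_bilin HP) cI' tI A10 A20 S10 S20.
have E := tr_powR_ge cI M0 S0.
have trS (X Y : 'M[C]_k) : complex.Re (\tr (t%:C *: X + (1 - t)%:C *: Y)) =
    t * complex.Re (\tr X) + (1 - t) * complex.Re (\tr Y).
  by rewrite mxtraceD !mxtraceZ cRe_add !cRe_realM.
have c0 : 0 <= c^-1 by rewrite invr_ge0; case/andP: cI' => ->.
exact: (weighted_comb_le c0 (trS _ _) (tr_powR_max cI M10) (tr_powR_max cI M20) E L).
Qed.

End TracePower.

(** * Operator convexity *)

Section OperatorConvex.
Context {R : realType}.
Local Notation C := R[i].
Local Notation "x %:C" := (real_complex R x) (format "x %:C") : ring_scope.

Lemma qf_real n (A : 'M[C]_n) x : adjmx A = A -> qf A x = (complex.Re (qf A x))%:C.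
Proof.
move=> Ah; have := qf_adj A x; rewrite Ah; case: (qf A x) => a b /eqP.
rewrite eq_complex /= eqxx /= => /eqP b0; congr (_ +i* _)%C.
have : b *+ 2 = 0 by rewrite mulr2n {2}b0 subrr.
by move/eqP; rewrite mulrn_eq0 /= => /eqP.
Qed.

Lemma qf_le_Re n (A B : 'M[C]_n) x : adjmx A = A -> adjmx B = B ->
  complex.Re (qf A x) <= complex.Re (qf B x) -> qf A x <= qf B x.
Proof. by move=> Ah Bh AB; rewrite (qf_real x Ah) (qf_real x Bh) lecR. Qed.

Lemma adjmx_form n (x v : 'cV[C]_n) : (adjmx v *m x) 0 0 = ((adjmx x *m v) 0 0)^*.
Proof.
have -> : adjmx v *m x = adjmx (adjmx x *m v) by rewrite adjmxM adjmxK.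
by rewrite adjmxE [LHS]mxE [X in X^*]mxE.
Qed.

Lemma cRe_conj (z : C) : complex.Re (z^*) = complex.Re z.
Proof. by case: z. Qed.

Lemma qf_expand n (M : 'M[C]_n) (u v : 'cV[C]_n) :
  qf M (u - v) = qf M u - (adjmx v *m M *m u) 0 0 - (adjmx u *m M *m v) 0 0 + qf M v.
Proof.
rewrite /qf adjmxD adjmxN !(mulmxDr, mulmxDl, mulmxN, mulNmx) opprK.
have addE (X Y : 'M[C]_1) : (X + Y) 0 0 = X 0 0 + Y 0 0 by rewrite mxE.
have oppE (X : 'M[C]_1) : (- X) 0 0 = - X 0 0 by rewrite mxE.
by rewrite !addE !oppE addrA.
Qed.

(** Completing the square: the form of [M] at [v - invmx M *m x] is nonnegative. The value at
    [invmx M] thus becomes a supremum of expressions affine in [M]. *)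
Lemma qf_inv_sup n (M : 'M[C]_n) (x v : 'cV[C]_n) : posdef M ->
  complex.Re ((adjmx x *m v) 0 0) *+ 2 - complex.Re (qf M v) <=
  complex.Re (qf (invmx M) x).
Proof.
move=> M0; have Mu := posdef_unit M0; have Ih := (posdef_inv M0).1.
have := posdef_psd M0 (v - invmx M *m x); rewrite qf_expand.
have -> : adjmx v *m M *m (invmx M *m x) = adjmx v *m x.
  by rewrite -mulmxA mulKVmx.
have -> : adjmx (invmx M *m x) *m M *m v = adjmx x *m v.
  by rewrite adjmxM Ih -(mulmxA (adjmx x)) mulVmx// mulmx1.
have -> : qf M (invmx M *m x) = qf (invmx M) x.
  by rewrite /qf adjmxM Ih -(mulmxA (adjmx x)) mulVmx// mulmx1 mulmxA.
rewrite adjmx_form lecE => /andP[_]; rewrite [X in X <= _]/=.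
rewrite !cRe_add !raddfN/= cRe_conj mulr2n; move: (complex.Re _) (complex.Re _) (complex.Re _).
by move=> a b c {M0 Mu Ih}; lra.
Qed.

Lemma qf_inv_max n (M : 'M[C]_n) (x : 'cV[C]_n) : posdef M ->
  complex.Re ((adjmx x *m (invmx M *m x)) 0 0) *+ 2 - complex.Re (qf M (invmx M *m x)) =
  complex.Re (qf (invmx M) x).
Proof.
move=> M0; have Mu := posdef_unit M0; have Ih := (posdef_inv M0).1.
have -> : qf M (invmx M *m x) = qf (invmx M) x.
  by rewrite /qf adjmxM Ih -(mulmxA (adjmx x)) mulVmx// mulmx1 mulmxA.
by rewrite mulmxA -/(qf _ _) mulr2n addrK.
Qed.

Lemma convex_comb_le (t l a1 a2 b1 b2 c1 c2 x : R) : 0 <= t <= 1 ->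
  l = t * a1 + (1 - t) * a2 -> t * b1 + (1 - t) * b2 <= x ->
  a1 *+ 2 - b1 <= c1 -> a2 *+ 2 - b2 <= c2 ->
  l *+ 2 - x <= t * c1 + (1 - t) * c2.
Proof.
case/andP=> t0 t1 -> H H1 H2; rewrite -subr_ge0 in t1.
by have := ler_wpM2l t0 H1; have := ler_wpM2l t1 H2; rewrite !mulr2n; lra.
Qed.

(** The optimal [v] at the combined point is a trial vector at both endpoints. Since the form of [M]
    is subtracted, [M] only has to dominate the combination of [M1] and [M2], which admits operator
    concave functions. *)
Lemma quad_over_lin_convex m n (t : R) (V V1 V2 : 'M[C]_(m, n)) (M M1 M2 : 'M[C]_m) x :
  0 <= t <= 1 -> posdef M -> posdef M1 -> posdef M2 ->
  V = t%:C *: V1 + (1 - t)%:C *: V2 ->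
  (forall v, t * complex.Re (qf M1 v) + (1 - t) * complex.Re (qf M2 v)
             <= complex.Re (qf M v)) ->
  complex.Re (qf (adjmx V *m invmx M *m V) x) <=
  t * complex.Re (qf (adjmx V1 *m invmx M1 *m V1) x) +
  (1 - t) * complex.Re (qf (adjmx V2 *m invmx M2 *m V2) x).
Proof.
move=> tI M0 M10 M20 VE H; rewrite !qf_conj -(qf_inv_max _ M0).
move: (invmx M *m _) => v.
refine (convex_comb_le tI _ (H v) (qf_inv_sup _ v M10) (qf_inv_sup _ v M20)).
rewrite VE mulmxDl -!scalemxAl adjmxD !adjmxZ !conjC_real mulmxDl -!scalemxAl.
have combE a b (X Y : 'M[C]_1) : (a *: X + b *: Y) 0 0 = a * X 0 0 + b * Y 0 0.
  by rewrite !mxE.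
by rewrite combE cRe_add !cRe_realM.
Qed.

(** The concavity theorem with a one-dimensional second variable fixed at 1: [w] evaluates the form
    at [x] and multiplies by the scalar. *)
Lemma mxpow_opconcave n (c t : R) (A1 A2 : 'M[C]_n) x : 0 <= c <= 1 -> 0 <= t <= 1 ->
  posdef A1 -> posdef A2 ->
  t * complex.Re (qf (mxpow A1 c) x) + (1 - t) * complex.Re (qf (mxpow A2 c) x) <=
  complex.Re (qf (mxpow (t%:C *: A1 + (1 - t)%:C *: A2) c) x).
Proof.
move=> cI tI A10 A20.
pose w (X : 'M[C]_n) (Y : 'M[C]_1) := qf X x * Y 0 0.
have Hw : pos_bilin w.
  split.
  - by move=> a X X' Y; rewrite /w qfD qfZ; ring.
  - by move=> a X Y Y'; rewrite /w !mxE; ring.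
  - move=> z y; rewrite /w mulr_ge0//; first exact: psd_adj.
    by rewrite mxE big_ord1 adjmxE !mxE mul_conjC_ge0.
have I0 : posdef (1%:M : 'M[C]_1).
  by rewrite -(rmorph1 (real_complex R)); apply: posdef_scalar.
have IE : t%:C *: 1%:M + (1 - t)%:C *: 1%:M = 1%:M :> 'M[C]_1.
  by rewrite -scalerDl -rmorphD/= addrC subrK scale1r.
have Ip : mxpow (1%:M : 'M[C]_1) (1 - c) = 1%:M.
  have U1 : unitary (1%:M : 'M[C]_1) by rewrite /unitary adjmx1 mulmx1.
  rewrite -{1}(spec_cst 1 U1) -(rmorph1 (real_complex R)) (mxpow_spec (fun=> 1) _ U1).
  by rewrite powR1 spec_cst.
have wE Y X : Y = 1%:M -> complex.Re (w X Y) = complex.Re (qf X x).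
  by move=> ->; rewrite /w mxE eqxx mulr1.
have Ip' : mxpow (t%:C *: 1%:M + (1 - t)%:C *: 1%:M : 'M[C]_1) (1 - c) = 1%:M.
  by rewrite IE.
have L := lieb_pos_bilin Hw cI tI A10 A20 I0 I0.
have K (a1 a2 a b1 b2 b : R) : a1 = b1 -> a2 = b2 -> a = b ->
  t * a1 + (1 - t) * a2 <= a -> t * b1 + (1 - t) * b2 <= b by move=> -> -> ->.
exact: (K _ _ _ _ _ _ (wE _ _ Ip) (wE _ _ Ip) (wE _ _ Ip') L).
Qed.

Lemma qf_convex_eq n (t : R) (X X1 X2 Y Y1 Y2 : 'M[C]_n) x : X = Y -> X1 = Y1 -> X2 = Y2 ->
  complex.Re (qf Y x) <= t * complex.Re (qf Y1 x) + (1 - t) * complex.Re (qf Y2 x) ->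
  complex.Re (qf X x) <= t * complex.Re (qf X1 x) + (1 - t) * complex.Re (qf X2 x).
Proof. by move=> -> -> ->. Qed.

Lemma mxpow_opconvex_neg n (q t : R) (B1 B2 : 'M[C]_n) x : -1 <= q <= 0 -> 0 <= t <= 1 ->
  posdef B1 -> posdef B2 ->
  complex.Re (qf (mxpow (t%:C *: B1 + (1 - t)%:C *: B2) q) x) <=
  t * complex.Re (qf (mxpow B1 q) x) + (1 - t) * complex.Re (qf (mxpow B2 q) x).
Proof.
move=> qI tI B10 B20; have B0 := posdef_convex tI B10 B20.
have cI : 0 <= - q <= 1 by case/andP: qI => ? ?; apply/andP; split; lra.
have E (B : 'M[C]_n) : posdef B -> mxpow B q = adjmx 1%:M *m invmx (mxpow B (- q)) *m 1%:M.
  by move=> HB; rewrite adjmx1 mul1mx mulmx1 -{1}[q]opprK (mxpowN (- q) HB).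
apply: (qf_convex_eq (E _ B0) (E _ B10) (E _ B20)).
refine (quad_over_lin_convex x tI (mxpow_posdef _ B0) (mxpow_posdef _ B10)
  (mxpow_posdef _ B20) _ (fun v => mxpow_opconcave v cI tI B10 B20)).
by rewrite -scalerDl -rmorphD/= addrC subrK scale1r.
Qed.

(** The factorisation [B ^ q = B * (B ^ (2 - q))^-1 * B] has [2 - q] in the interval of operator
    concavity and a numerator linear in [B]. *)
Lemma mxpow_opconvex_12 n (q t : R) (B1 B2 : 'M[C]_n) x : 1 <= q <= 2 -> 0 <= t <= 1 ->
  posdef B1 -> posdef B2 ->
  complex.Re (qf (mxpow (t%:C *: B1 + (1 - t)%:C *: B2) q) x) <=
  t * complex.Re (qf (mxpow B1 q) x) + (1 - t) * complex.Re (qf (mxpow B2 q) x).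
Proof.
move=> qI tI B10 B20; have B0 := posdef_convex tI B10 B20.
have cI : 0 <= 2 - q <= 1 by case/andP: qI => ? ?; apply/andP; split; lra.
have E (B : 'M[C]_n) : posdef B -> mxpow B q = adjmx B *m invmx (mxpow B (2 - q)) *m B.
  move=> HB; have -> : adjmx B = B by case: HB.
  rewrite -(mxpowN _ HB) -[X in _ = X *m _ *m _](mxpow1 HB) -[X in _ = _ *m X](mxpow1 HB).
  by rewrite -!(mxpowD _ _ HB); congr (mxpow _ _); ring.
apply: (qf_convex_eq (E _ B0) (E _ B10) (E _ B20)).
refine (quad_over_lin_convex x tI (mxpow_posdef _ B0) (mxpow_posdef _ B10)
  (mxpow_posdef _ B20) erefl (fun v => mxpow_opconcave v cI tI B10 B20)).
Qed.

Lemma posmap_le n k (P : 'M[C]_n -> 'M[C]_k) (t : R) (X X1 X2 : 'M[C]_n) : posmap P ->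
  adjmx X = X -> adjmx X1 = X1 -> adjmx X2 = X2 ->
  (forall x, complex.Re (qf X x) <=
     t * complex.Re (qf X1 x) + (1 - t) * complex.Re (qf X2 x)) ->
  forall y, complex.Re (qf (P X) y) <=
     t * complex.Re (qf (P X1) y) + (1 - t) * complex.Re (qf (P X2) y).
Proof.
move=> HP Xh X1h X2h H y.
pose D := t%:C *: X1 + ((1 - t)%:C *: X2 + (-1) *: X).
have Dh : adjmx D = D by rewrite !adjmxD !adjmxZ !conjC_real rmorphN1 Xh X1h X2h.
have Dq x : complex.Re (qf D x) = t * complex.Re (qf X1 x) + (1 - t) * complex.Re (qf X2 x)
     - complex.Re (qf X x).
  by rewrite !qfD !qfZ !cRe_add !cRe_realM addrA mulN1r raddfN.
have Dp : psd D by move=> x; rewrite (qf_real x Dh) lecR Dq subr_ge0.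
have [Pl _] := HP.
have P0 : P 0 = 0.
  have := Pl (-1) 0 0; rewrite scaler0 addr0 scaleN1r addNr; exact.
have PE : P D = t%:C *: P X1 + ((1 - t)%:C *: P X2 + (-1) *: P X).
  by rewrite !Pl -[(-1) *: X]addr0 Pl P0 addr0.
have := posmap_psd HP Dh Dp y; rewrite PE !qfD !qfZ lecE => /andP[_].
by rewrite !cRe_add !cRe_realM addrA mulN1r raddfN/= subr_ge0.
Qed.

End OperatorConvex.

(** * Inverses of positive maps *)

Section PositiveMapInverse.
Context {R : realType}.
Local Notation C := R[i].
Local Notation "x %:C" := (real_complex R x) (format "x %:C") : ring_scope.

Definition sf n (M : 'M[C]_n) (u v : 'cV[C]_n) : C := (adjmx u *m M *m v) 0 0.

Lemma sf_sum n (I : Type) (r : seq I) (c : I -> R) (E : I -> 'M[C]_n) u v :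
  complex.Re (sf (\sum_(i <- r) (c i)%:C *: E i) u v) =
  \sum_(i <- r) c i * complex.Re (sf (E i) u v).
Proof.
rewrite /sf mulmx_sumr mulmx_suml summxE cRe_sum; apply: eq_bigr => i _.
by rewrite -scalemxAr -scalemxAl [in LHS]mxE cRe_realM.
Qed.

Lemma posmap_sum n k (P : 'M[C]_n -> 'M[C]_k) (I : Type) (r : seq I)
    (c : I -> C) (E : I -> 'M[C]_n) : posmap P ->
  P (\sum_(i <- r) c i *: E i) = \sum_(i <- r) c i *: P (E i).
Proof.
case=> Pl _; elim: r => [|i r IH]; last by rewrite !big_cons Pl IH.
by rewrite !big_nil; have := Pl (-1) 0 0; rewrite scaler0 addr0 scaleN1r addNr; exact.
Qed.

Lemma posmap_congr_spec n k (P : 'M[C]_n -> 'M[C]_k) (L U : 'M[C]_n) (c : 'I_n -> C) :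
  posmap P -> P (L *m spec U c *m adjmx L) =
  \sum_i c i *: P ((L *m col i (adjmx U)) *m adjmx (L *m col i (adjmx U))).
Proof.
move=> HP; rewrite -(posmap_sum _ _ _ HP); congr P.
rewrite spec_sum mulmx_sumr mulmx_suml; apply: eq_bigr => i _.
by rewrite -scalemxAr -scalemxAl adjmxM !mulmxA.
Qed.

Lemma psd_cross_le n (E : 'M[C]_n) (u y : 'cV[C]_n) (d : R) : psd E -> 0 < d ->
  complex.Re (sf E y u) + complex.Re (sf E u y) <=
  d^-1 * complex.Re (sf E u u) + d * complex.Re (sf E y y).
Proof.
move=> Ep d0; have := Ep (u - d%:C *: y).
have SE c (X : 'M[C]_1) : (c%:C *: X) 0 0 = c%:C * X 0 0 by rewrite mxE.
have -> : qf E (u - d%:C *: y) =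
    sf E u u - d%:C * sf E y u - d%:C * sf E u y + d%:C * (d%:C * sf E y y).
  by rewrite qf_expand /qf /sf adjmxZ conjC_real -!scalemxAr -!scalemxAl !SE.
move: (sf E u u) (sf E y u) (sf E u y) (sf E y y) => a b c e {SE Ep E}.
have ReN z : complex.Re (- z) = - complex.Re z :> R by case: z.
rewrite lecE => /andP[_]; rewrite !cRe_add !ReN !cRe_realM.
move: (complex.Re a) (complex.Re b) (complex.Re c) (complex.Re e) => {}a {}b {}c {}e H.
have di0 : 0 <= d^-1 by rewrite invr_ge0 ltW.
have := ler_wpM2l di0 H.
have -> : d^-1 * (a - d * b - d * c + d * (d * e)) = d^-1 * a + d * e - (b + c).
  by field; rewrite gt_eqF.
by rewrite mulr0 subr_ge0.
Qed.

Lemma unitmx_inj n (A : 'M[C]_n) : A \in unitmx -> forall x : 'cV_n, A *m x = 0 -> x = 0.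
Proof. by move=> Au x H; rewrite -[x](mulKmx Au) H mulmx0. Qed.

Lemma invmx_congr n (L N : 'M[C]_n) : L \in unitmx -> N \in unitmx ->
  L *m invmx (L *m N *m L) *m L = invmx N.
Proof.
move=> Lu Nu; have Hu : L *m N *m L \in unitmx by rewrite !unitmx_mul Lu Nu.
have E : N *m (L *m invmx (L *m N *m L) *m L) = 1%:M.
  rewrite -[LHS](mulKmx Lu) -[RHS](mulKmx Lu) mulmx1; congr (_ *m _).
  by rewrite !mulmxA -(mulmxA L N) mulmxA mulmxV// mul1mx.
by rewrite -[LHS](mulKmx Nu) E mulmx1.
Qed.

(** Writing [L *m N *m L] with [L = K ^ (1 / 2)] in an eigenbasis gives positive [E i] with
    [P K = \sum E i], [P (invmx N) = \sum (d i)^-1 E i] and [P (K *m N *m K) = \sum d i E i]. For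
    this common family the inequality is a Cauchy-Schwarz estimate for each [i], which needs only
    positivity. The free parameter [K] moves the point of equality, [N = invmx K]. *)
Lemma choi_inv n k (P : 'M[C]_n -> 'M[C]_k) (N K : 'M[C]_n) v :
  posmap P -> posdef N -> posdef K ->
  complex.Re (qf (invmx (P (invmx N))) v) <=
  complex.Re (qf (invmx (P K) *m P (K *m N *m K) *m invmx (P K)) v).
Proof.
move=> HP N0 K0; have [_ Pp] := HP.
have L0 := mxpow_posdef (2^-1) K0; set L := mxpow K _ in L0.
have Lu := posdef_unit L0; have Lh : adjmx L = L := L0.1.
have LL : L *m L = K.
  by rewrite /L -(mxpowD _ _ K0) -[RHS](mxpow1 K0); congr (mxpow _ _); field.
clearbody L.
have H0 : posdef (L *m N *m L).
  by rewrite -{1}Lh; apply: posdef_congr N0 (unitmx_inj Lu).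
have [U [d [UU d0 HE]]] := posdef_spec H0.
have dn0 i : (d i)%:C != 0.
  by rewrite -(rmorph0 (real_complex R)) (inj_eq (@complexI _)) gt_eqF.
pose E i := P ((L *m col i (adjmx U)) *m adjmx (L *m col i (adjmx U))).
have Ep i : psd (E i).
  by apply: (posmap_psd HP); [rewrite adjmxM adjmxK|exact: psd_adj].
have PK : P K = \sum_i 1%:C *: E i.
  rewrite -(posmap_congr_spec L U (fun=> 1%:C) HP) spec_cst// Lh.
  by rewrite mul_mx_scalar -scalemxAl scale1r LL.
have PN : P (invmx N) = \sum_i ((d i)^-1)%:C *: E i.
  rewrite -(posmap_congr_spec L U (fun i => ((d i)^-1)%:C) HP) Lh.
  congr P; rewrite -(invmx_congr Lu (posdef_unit N0)) HE (spec_inv UU dn0).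
  rewrite (@eq_spec _ _ U _ (fun i => ((d i)^-1)%:C)); first reflexivity.
  by move=> i; rewrite fmorphV.
have PKNK : P (K *m N *m K) = \sum_i (d i)%:C *: E i.
  by rewrite -(posmap_congr_spec L U (fun i => (d i)%:C) HP) Lh -HE -LL !mulmxA.
have PK0 := Pp _ K0; have PKu := posdef_unit PK0.
have Wh : adjmx (invmx (P K)) = invmx (P K) := (posdef_inv PK0).1.
have M0 := Pp _ (posdef_inv N0).
have -> : complex.Re (qf (invmx (P K) *m P (K *m N *m K) *m invmx (P K)) v) =
    complex.Re (sf (P (K *m N *m K)) (invmx (P K) *m v) (invmx (P K) *m v)).
  by rewrite -{1}Wh qf_conj.
(* The left side is replaced by its variational expression at the optimal vector; the rest holds for
   any [u], so its origin is forgotten. *)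
rewrite -(qf_inv_max v M0); set u := invmx (P (invmx N)) *m v; clearbody u.
set y := invmx (P K) *m v.
have vE : adjmx v *m u = adjmx y *m P K *m u.
  by rewrite /y adjmxM Wh -(mulmxA (adjmx v)) mulVmx// mulmx1.
rewrite vE -[(adjmx y *m P K *m u) 0 0]/(sf (P K) y u).
have sfC : complex.Re (sf (P K) u y) = complex.Re (sf (P K) y u).
  rewrite /sf -mulmxA adjmx_form cRe_conj adjmxM; congr (complex.Re (_ 0 0)).
  by have -> : adjmx (P K) = P K := PK0.1.
clearbody y; rewrite mulr2n -{2}sfC -[qf _ u]/(sf (P (invmx N)) u u).
rewrite PK PN PKNK !sf_sum lerBlDr -!big_split/=; apply: ler_sum => i _.
by rewrite !mul1r addrC [leRHS]addrC [leLHS]addrC; exact: psd_cross_le.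
Qed.

Lemma tr_inv_powR_concave n l k (P : 'M[C]_n -> 'M[C]_l) (Z : 'M[C]_(l, k)) (c t : R) A1 A2 :
  posmap P -> (forall x : 'cV_k, Z *m x = 0 -> x = 0) ->
  0 < c < 1 -> 0 <= t <= 1 -> posdef A1 -> posdef A2 ->
  t * complex.Re (\tr (mxpow (adjmx Z *m invmx (P (mxpow A1 (- c))) *m Z) c^-1)) +
  (1 - t) * complex.Re (\tr (mxpow (adjmx Z *m invmx (P (mxpow A2 (- c))) *m Z) c^-1)) <=
  complex.Re (\tr (mxpow (adjmx Z *m
     invmx (P (mxpow (t%:C *: A1 + (1 - t)%:C *: A2) (- c))) *m Z) c^-1)).
Proof.
move=> HP Zi cI tI A10 A20; have A0 := posdef_convex tI A10 A20.
have [Pl Pp] := HP.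
move: (erefl (t%:C *: A1 + (1 - t)%:C *: A2)) A0.
move: {1 3 4}(t%:C *: A1 + _) => A AE A0.
(* [K] is frozen at the combined point: the concave majorant built from [Xi] touches there, because
   [K *m A ^ c *m K = K]. Injectivity of [Z] keeps [Xi] strictly positive. *)
pose K := mxpow A (- c); have K0 : posdef K := mxpow_posdef _ A0.
have PK0 := Pp _ K0; have W0 := posdef_inv PK0.
pose Xi (X : 'M[C]_n) :=
  adjmx Z *m (invmx (P K) *m P (K *m X *m K) *m invmx (P K)) *m Z.
have XiP : posmap Xi.
  split.
    move=> a X Y; rewrite /Xi mulmxDr mulmxDl -scalemxAr -scalemxAl Pl.
    by rewrite !(mulmxDr, mulmxDl) -!scalemxAr -!scalemxAl -!scalemxAr -!scalemxAl.
  move=> X X0; apply: posdef_congr Zi; rewrite -{1}W0.1.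
  apply: posdef_congr (unitmx_inj (posdef_unit W0)); apply: Pp; rewrite -{1}K0.1.
  exact: posdef_congr X0 (unitmx_inj (posdef_unit K0)).
have dom (B : 'M[C]_n) : posdef B ->
    complex.Re (\tr (mxpow (adjmx Z *m invmx (P (mxpow B (- c))) *m Z) c^-1)) <=
    complex.Re (\tr (mxpow (Xi (mxpow B c)) c^-1)).
  move=> B0; have Bc0 := mxpow_posdef c B0.
  have V0 := posdef_inv (Pp _ (mxpow_posdef (- c) B0)).
  have G0 := posdef_congr V0 Zi; have X0 := XiP.2 _ Bc0.
  apply: (tr_powR_mono cI G0 X0) => x; apply: (qf_le_Re G0.1 X0.1).
  rewrite !qf_conj (mxpowN _ B0); exact: choi_inv HP Bc0 K0.
have eqA : Xi (mxpow A c) = adjmx Z *m invmx (P (mxpow A (- c))) *m Z.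
  rewrite /Xi; congr (_ *m _ *m _); rewrite /K -!(mxpowD _ _ A0).
  have -> : - c + c + - c = - c by ring.
  by rewrite mulVmx ?mul1mx//; exact: posdef_unit PK0.
have [t0 t1] : 0 <= t /\ 0 <= 1 - t by case/andP: tI => ? ?; split; rewrite ?subr_ge0.
have L := tr_powR_concave XiP cI tI A10 A20; rewrite -AE eqA in L.
refine (le_trans _ L).
exact: lerD (ler_wpM2l t0 (dom _ A10)) (ler_wpM2l t1 (dom _ A20)).
Qed.

End PositiveMapInverse.

(** * Weak majorization *)

Section Majorization.
Context {R : realType}.

Lemma convex_slope (g : R -> R) (z y w : R) : convex_pos g -> 0 < z -> z < y -> y < w ->
  (g y - g z) / (y - z) <= (g w - g y) / (w - y).
Proof.
move=> gc z0 zy yw; have wz : 0 < w - z by lra.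
have tI : 0 <= (w - y) / (w - z) <= 1.
  by rewrite divr_ge0 ?ler_pdivrMr//=; lra.
have w0 : 0 < w by lra.
have := gc z w _ z0 w0 tI.
have -> : (w - y) / (w - z) * z + (1 - (w - y) / (w - z)) * w = y.
  by field; rewrite gt_eqF.
have -> : (w - y) / (w - z) * g z + (1 - (w - y) / (w - z)) * g w =
  ((w - y) * g z + (y - z) * g w) / (w - z) by field; rewrite gt_eqF.
rewrite ler_pdivlMr// => H.
rewrite ler_pdivrMr ?subr_gt0// mulrAC ler_pdivlMr ?subr_gt0//; nra.
Qed.

(** [c y] is the supremum of the chord slopes to the left of [y], that is the left derivative;
    chords to the right bound it from above. *)
Lemma convex_subgradient (g : R -> R) : convex_pos g ->
  exists c : R -> R, forall y z, 0 < y -> 0 < z -> g y + c y * (z - y) <= g z.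
Proof.
move=> gc.
pose E y : set R := fun r => exists2 z, 0 < z < y & r = (g y - g z) / (y - z).
exists (fun y => sup (E y)) => y z y0 z0.
have E0 : (E y !=set0)%classic.
  by exists ((g y - g (y / 2)) / (y - y / 2)), (y / 2) => //; apply/andP; split; lra.
have Eub w : y < w -> ubound (E y) ((g w - g y) / (w - y)).
  by move=> yw _ [v /andP[v0 vy] ->]; apply: convex_slope.
have Eh : has_sup (E y).
  by split=> //; exists ((g (y + 1) - g y) / (y + 1 - y)); apply: Eub; lra.
have [zy|zy|->] := ltgtP z y; last by rewrite subrr mulr0 addr0.
- have := sup_upper_bound Eh; move/(_ ((g y - g z) / (y - z))).
  have yz : 0 < y - z by rewrite subr_gt0.
  have Ez : E y ((g y - g z) / (y - z)) by exists z => //; rewrite z0.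
  by move=> /(_ Ez); rewrite ler_pdivrMr//; lra.
- have yz : 0 < z - y by rewrite subr_gt0.
  by have := ge_sup E0 (Eub z zy); rewrite ler_pdivlMr//; lra.
Qed.

(** Summation by parts, in the inductive form that the last weight times a partial sum is below the
    weighted partial sum. Nonnegative weights handle the total sum, which is only known to be
    nonnegative. *)
Lemma abel_ge0 l (c e : nat -> R) :
  (forall k, (k <= l)%N -> 0 <= \sum_(i < k) e i) ->
  (forall i, (i.+1 < l)%N -> c i.+1 <= c i) ->
  (forall i, (i < l)%N -> 0 <= c i) -> 0 <= \sum_(i < l) c i * e i.
Proof.
case: l => [|l] He Hc c0; first by rewrite big_ord0.
suff H k : (k <= l)%N -> c k * \sum_(i < k.+1) e i <= \sum_(i < k.+1) c i * e i.
  by apply: le_trans (H l (leqnn l)); rewrite mulr_ge0 ?c0 ?He.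
elim: k => [|k IH] kl; first by rewrite !big_ord1.
rewrite big_ord_recr [leRHS]big_ord_recr/= mulrDr lerD2r.
apply: le_trans (IH (ltnW kl)); rewrite ler_wpM2r ?Hc//.
exact: He (leqW kl).
Qed.

Lemma top_sum_ge l k (x r : 'I_l -> R) : (k <= l)%N ->
  (forall i j : 'I_l, (i <= j)%N -> x j <= x i) ->
  (forall i, 0 <= r i <= 1) -> \sum_i r i = k%:R ->
  \sum_i r i * x i <= \sum_(i < l | (i < k)%N) x i.
Proof.
move=> kl xs rI rk; case: k => [|k] in kl rk *.
  rewrite [leRHS]big1// big1// => i _.
  have /eqP := rk; rewrite psumr_eq0 => [|j _]; last by case/andP: (rI j).
  by move=> /allP/(_ i (mem_index_enum _))/eqP ->; rewrite mul0r.
(* [p] is the smallest of the entries kept. As the weights have equal totals, [p] may be subtracted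
   from every [x i], after which each term has a sign. *)
pose p := x (Ordinal kl).
have E : \sum_(i < l) ((i < k.+1)%N)%:R = k.+1%:R :> R.
  transitivity (\sum_(i < l | (i < k.+1)%N) (1 : R)).
    by rewrite [RHS]big_mkcond; apply: eq_bigr => i _; case: ifP.
  by rewrite -(big_ord_widen l (fun=> 1 : R) kl) sumr_const card_ord.
have -> : \sum_(i < l | (i < k.+1)%N) x i = \sum_(i < l) ((i < k.+1)%N)%:R * x i.
  by rewrite big_mkcond; apply: eq_bigr => i _; case: ifP; rewrite ?mul1r ?mul0r.
rewrite -subr_ge0 -sumrB.
have -> : \sum_(i < l) (((i < k.+1)%N)%:R * x i - r i * x i) =
    \sum_(i < l) (((i < k.+1)%N)%:R - r i) * (x i - p).
  have -> : \sum_(i < l) (((i < k.+1)%N)%:R - r i) * (x i - p) =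
     \sum_(i < l) (((i < k.+1)%N)%:R * x i - r i * x i) - (\sum_(i < l) ((i < k.+1)%N)%:R - \sum_i r i) * p.
    rewrite mulrBl !mulr_suml -!sumrB; apply: eq_bigr => i _; ring.
  by rewrite E rk subrr mul0r subr0.
apply: sumr_ge0 => i _; case: (ltnP i k.+1) => ik /=; case/andP: (rI i) => r0 r1.
  by rewrite mulr_ge0 ?subr_ge0//; apply: xs; rewrite /= -ltnS.
by rewrite sub0r mulNr -mulrN mulr_ge0// opprB subr_ge0; apply: xs; apply: ltnW.
Qed.

(** Tangents to [g] are taken at the [y i]: their slopes are nonnegative since [g] is nondecreasing,
    and decrease with [i] since [g] is convex and [y] is sorted. Abel summation against the partial
    sum inequalities then concludes. *)
Lemma majorize_convex l (g : R -> R) (y y1 y2 : 'I_l -> R) (t : R) :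
  nondecreasing_pos g -> convex_pos g -> 0 <= t <= 1 ->
  (forall i, 0 < y i) -> (forall i, 0 < y1 i) -> (forall i, 0 < y2 i) ->
  (forall i j : 'I_l, (i <= j)%N -> y j <= y i) ->
  (forall k, (k <= l)%N -> \sum_(i < l | (i < k)%N) y i <=
     t * \sum_(i < l | (i < k)%N) y1 i + (1 - t) * \sum_(i < l | (i < k)%N) y2 i) ->
  \sum_i g (y i) <= t * \sum_i g (y1 i) + (1 - t) * \sum_i g (y2 i).
Proof.
move=> gm gc /andP[t0 t1] y0 y10 y20 ys H; rewrite -subr_ge0 in t1.
have [c Hc] := convex_subgradient gc.
have c0 a : 0 < a -> 0 <= c a.
  move=> a0; have a20 : 0 < a / 2 by lra.
  have a2 : a / 2 <= a by lra.
  have := Hc a (a / 2) a0 a20; have := gm _ _ a20 a2; nra.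
have cm a b : 0 < a -> a <= b -> c a <= c b.
  move=> a0; rewrite le_eqVlt => /predU1P[->//|ab].
  have b0 : 0 < b by lra.
  have := Hc a b a0 b0; have := Hc b a b0 a0 => H1 H2.
  have : 0 < b - a by lra.
  move: (c a) (c b) H1 H2 => ca cb; nra.
pose e i := t * y1 i + (1 - t) * y2 i - y i.
suff He : 0 <= \sum_i c (y i) * e i.
  rewrite !mulr_sumr -big_split/= -subr_ge0 -sumrB; apply: le_trans He _.
  apply: ler_sum => i _.
  have := ler_wpM2l t0 (Hc _ _ (y0 i) (y10 i)).
  by have := ler_wpM2l t1 (Hc _ _ (y0 i) (y20 i)); rewrite /e; lra.
(* The summation lemma works with sequences on [nat]; the value 0 beyond [l] never enters the
   sums. *)
pose ext (h : 'I_l -> R) (j : nat) := oapp h 0 (insub j : option 'I_l).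
have extE h (i : 'I_l) : ext h i = h i by rewrite /ext valK.
have -> : \sum_i c (y i) * e i = \sum_(i < l) (ext (fun i => c (y i)) i) * (ext e i).
  by apply: eq_bigr => i _; rewrite !extE.
apply: abel_ge0.
- move=> k kl.
  have -> : \sum_(i < k) ext e i = \sum_(i < l | (i < k)%N) e i.
    rewrite (big_ord_widen l (ext e) kl); apply: eq_bigr => i _; exact: extE.
  by rewrite sumrB subr_ge0 big_split/= -!mulr_sumr H.
- move=> i il; have il' := ltnW il.
  rewrite (extE _ (Ordinal il)) (extE _ (Ordinal il')); apply: cm => //.
  by apply: ys => /=.
- by move=> i il; rewrite (extE _ (Ordinal il)) c0.
Qed.

Lemma young_top (c x e : R) : 0 < c < 1 -> 0 < x -> 0 < e ->
  (1 - c)^-1 * (x * e) <= x `^ ((1 - c)^-1) + ((1 - c)^-1 - 1) * e `^ (c^-1).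
Proof.
move=> /andP[c0 c1] x0 e0; have c10 : 0 < 1 - c by rewrite subr_gt0.
have := @conjugate_powR R x e ((1 - c)^-1) (c^-1) (ltW x0) (ltW e0).
rewrite !invr_gt0 c0 c10 !invrK subrK => /(_ isT isT erefl) H.
have ci0 : 0 <= (1 - c)^-1 by rewrite invr_ge0 ltW.
have := ler_wpM2l ci0 H.
have -> : (1 - c)^-1 * (x `^ (1 - c)^-1 * (1 - c) + e `^ c^-1 * c) =
  x `^ (1 - c)^-1 + ((1 - c)^-1 - 1) * e `^ c^-1 by field; rewrite gt_eqF.
by [].
Qed.

End Majorization.

(** * Ky Fan sums *)

Section KyFan.
Context {R : realType}.
Local Notation C := R[i].
Local Notation "x %:C" := (real_complex R x) (format "x %:C") : ring_scope.

Lemma sort_perm n (d : 'I_n -> R) :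
  exists s : {perm 'I_n}, forall i j : 'I_n, (i <= j)%N -> d (s j) <= d (s i).
Proof.
pose leT (a b : 'I_n) := d b <= d a.
have leTt : transitive leT by move=> a b c ba ac; apply: le_trans ac ba.
have leTr : reflexive leT by move=> a; apply: lexx.
have tot : total leT by move=> a b; apply: le_total.
have sz : size (sort leT (ord_tuple n)) == n by rewrite size_sort size_tuple.
have : perm_eq (Tuple sz) (ord_tuple n) by rewrite perm_sort.
case/tuple_permP => p Ep; exists p => i j ij.
have := sorted_leq_nth leTt leTr (p i) (sort_sorted tot (ord_tuple n)).
have E (k : 'I_n) : nth (p i) (sort leT (ord_tuple n)) k = p k.
  have -> : sort leT (ord_tuple n) = [tuple tnth (ord_tuple n) (p i) | i < n] :> seq _.
    by rewrite -Ep.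
  by rewrite (nth_map k) ?size_enum_ord// nth_ord_enum tnth_ord_tuple.
have inn (k : 'I_n) : (k : nat) \in [pred m | (m < size (sort leT (ord_tuple n)))%N].
  by rewrite inE (eqP sz) ltn_ord.
by move=> /(_ i j (inn i) (inn j) ij); rewrite !E.
Qed.

Lemma posdef_spec_sorted n (A : 'M[C]_n) : posdef A -> exists U (d : 'I_n -> R),
  [/\ unitary U, forall i, 0 < d i, forall i j : 'I_n, (i <= j)%N -> d j <= d i
    & A = spec U (fun i => (d i)%:C)].
Proof.
move=> /posdef_spec[U [d [UU d0 ->]]]; have [s Hs] := sort_perm d.
exists (\matrix_(i, j) U (s i) j), (d \o s); split=> //.
- apply/matrixP => i j; have /matrixP/(_ (s i) (s j)) := UU.
  rewrite !mxE (inj_eq perm_inj) => <-; apply: eq_bigr => k _.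
  by rewrite !adjmxE !mxE.
- by move=> i; apply: d0.
rewrite !spec_sum (reindex_inj (@perm_inj _ s))/=; apply: eq_bigr => b _.
have -> : col b (adjmx (\matrix_(i, j) U (s i) j)) = col (s b) (adjmx U); last by [].
by apply/matrixP => i j; rewrite !mxE.
Qed.

Lemma isometry_col_sqn l k (N : 'M[C]_(l, k)) b : adjmx N *m N = 1%:M ->
  \sum_i sqn (N i b) = 1.
Proof.
move=> /matrixP/(_ b b); rewrite !mxE eqxx => H; apply: (@complexI R).
rewrite rmorph_sum rmorph1 -[RHS]H /=; apply: eq_bigr => j _.
by rewrite [LHS]sqnE normCK adjmxE !mxE mulrC.
Qed.

(** The row sum [r] is a diagonal entry of the projection [N *m adjmx N], hence also the squared
    norm of a row of it, so [r ^+ 2 <= r]. *)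
Lemma isometry_row_sqn l k (N : 'M[C]_(l, k)) i : adjmx N *m N = 1%:M ->
  \sum_b sqn (N i b) <= 1.
Proof.
move=> NN; pose Q := N *m adjmx N; set r := \sum_b _.
have QE : Q i i = r%:C.
  rewrite mxE rmorph_sum /=; apply: eq_bigr => j _.
  by rewrite [RHS]sqnE normCK adjmxE !mxE.
have Qh : adjmx Q = Q by rewrite adjmxM adjmxK.
have QQ : Q *m Q = Q by rewrite /Q -mulmxA (mulmxA _ N) NN mul1mx.
have rE : r = \sum_j sqn (Q i j).
  apply: (@complexI R); rewrite -QE -{1}QQ mxE rmorph_sum /=; apply: eq_bigr => j _.
  rewrite [RHS]sqnE normCK; congr (_ * _).
  by rewrite -{1}Qh adjmxE !mxE.
have r0 : 0 <= r by apply: sumr_ge0 => b _; apply: sqn_ge0.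
have : r ^+ 2 <= r.
  rewrite {2}rE (bigD1 i)//= QE; apply: le_trans (_ : sqn r%:C <= _).
    by rewrite /sqn /= expr0n addr0.
  by rewrite lerDl; apply: sumr_ge0 => b _; apply: sqn_ge0.
by clear -r0; nra.
Qed.

Lemma adjmx_entry m n (A : 'M[C]_(m, n)) i j : adjmx A i j = (A j i)^*.
Proof. by rewrite adjmxE !mxE. Qed.

Lemma mxtrace_unitary n (E G : 'M[C]_n) : unitary E -> \tr (E *m G *m adjmx E) = \tr G.
Proof. by move=> EE; rewrite mxtrace_mulC mulmxA (unitary_adjl EE) mul1mx. Qed.

(** The columns of [U *m V *m adjmx E] are orthogonal with squared norms [e b]; normalised, they
    form an isometry [N]. The trace is an average of [x i * e b] with weights [sqn (N i b)], whose
    column sums are 1 and row sums at most 1, so [top_sum_ge] applies to [y]. Keeping [y], [pen] and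
    [s] abstract covers both the power case and the linear case. *)
Lemma kyfan_bound l k (U : 'M[C]_l) (x y : 'I_l -> R) (V : 'M[C]_(l, k))
    (E : 'M[C]_k) (e pen : 'I_k -> R) (s : R) : (k <= l)%N ->
  unitary U -> unitary E -> (forall b, 0 < e b) ->
  adjmx V *m V = spec E (fun b => (e b)%:C) ->
  (forall i j : 'I_l, (i <= j)%N -> y j <= y i) ->
  (forall i b, s * (x i * e b) <= y i + pen b) ->
  s * complex.Re (\tr (adjmx V *m spec U (fun i => (x i)%:C) *m V)) <=
  \sum_(i < l | (i < k)%N) y i + \sum_b pen b.
Proof.
move=> kl UU EE e0 VV ys yp.
pose T := U *m V *m adjmx E.
have TT : adjmx T *m T = diag_mx (\row_b (e b)%:C).
  rewrite /T !adjmxM adjmxK -!mulmxA (mulmxA (adjmx U)) unitary_adjl// mul1mx.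
  rewrite (mulmxA (adjmx V)) VV.
  have -> : spec E (fun b => (e b)%:C) = adjmx E *m diag_mx (\row_b (e b)%:C) *m E by [].
  by rewrite -!mulmxA EE mulmx1 mulmxA EE mul1mx.
have trE : \tr (adjmx V *m spec U (fun i => (x i)%:C) *m V) =
     \tr (adjmx T *m diag_mx (\row_i (x i)%:C) *m T).
  have -> : spec U (fun i => (x i)%:C) = adjmx U *m diag_mx (\row_i (x i)%:C) *m U by [].
  have -> : adjmx T = E *m adjmx V *m adjmx U by rewrite /T !adjmxM adjmxK mulmxA.
  by rewrite -[LHS](mxtrace_unitary _ EE) /T !mulmxA.
rewrite trE; clearbody T; clear trE VV V UU U EE E.
pose q b := Num.sqrt (e b).
have q0 b : 0 < q b by rewrite sqrtr_gt0.
have qq b : q b ^+ 2 = e b by rewrite sqr_sqrtr ?ltW.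
pose N := \matrix_(i, b) (((q b)^-1)%:C * T i b).
have NE i b : N i b = ((q b)^-1)%:C * T i b by rewrite mxE.
clearbody N.
have NN : adjmx N *m N = 1%:M.
  apply/matrixP => a b; rewrite [LHS]mxE [RHS]mxE.
  have H : \sum_i adjmx T a i * T i b = (e a)%:C *+ (a == b).
    by have := congr1 (fun M : 'M_k => M a b) TT; rewrite mxE => ->; rewrite !mxE.
  transitivity (((q a)^-1)%:C * ((q b)^-1)%:C * ((e a)%:C *+ (a == b))).
    rewrite -H mulr_sumr; apply: eq_bigr => i _.
    by rewrite !adjmx_entry !NE rmorphM/= conjC_real; ring.
  have [->|_] := eqVneq a b; last by rewrite mulr0n mulr0.
  rewrite !mulr1n -!rmorphM -(rmorph1 (real_complex R)); congr (_%:C).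
  by rewrite -qq; field; rewrite gt_eqF.
have TN i b : sqn (T i b) = e b * sqn (N i b).
  rewrite -qq NE /sqn; case: (T i b) => u v /=; rewrite !mul0r subr0 addr0.
  by field; rewrite gt_eqF.
have -> : complex.Re (\tr (adjmx T *m diag_mx (\row_i (x i)%:C) *m T)) =
    \sum_b \sum_i sqn (N i b) * (x i * e b).
  rewrite /mxtrace cRe_sum; apply: eq_bigr => b _.
  rewrite mul_mx_diag [_ b b]mxE cRe_sum; apply: eq_bigr => i _.
  rewrite [(\matrix_(_, _) _) b i]mxE [(\row_ _ _) _ _]mxE adjmx_entry.
  by rewrite mulrAC -normCKC -sqnE TN -rmorphM /=; ring.
pose r i := \sum_b sqn (N i b).
have H : \sum_i r i * y i <= \sum_(i < l | (i < k)%N) y i.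
  apply: top_sum_ge => // [i|].
    by rewrite isometry_row_sqn// andbT; apply: sumr_ge0 => b _; apply: sqn_ge0.
  rewrite exchange_big/= (eq_bigr (fun=> 1)) ?sumr_const ?card_ord// => b _.
  exact: isometry_col_sqn.
apply: le_trans (_ : \sum_i r i * y i + \sum_b pen b <= _); last by rewrite lerD2r.
have -> : \sum_b pen b = \sum_b \sum_i sqn (N i b) * pen b.
  by apply: eq_bigr => b _; rewrite -mulr_suml isometry_col_sqn// mul1r.
have -> : \sum_i r i * y i = \sum_b \sum_i sqn (N i b) * y i.
  by rewrite exchange_big/=; apply: eq_bigr => i _; rewrite mulr_suml.
rewrite mulr_sumr -big_split/=; apply: ler_sum => b _.
rewrite mulr_sumr -big_split/=; apply: ler_sum => i _.
by rewrite -mulrDr mulrCA ler_wpM2l ?sqn_ge0.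
Qed.

End KyFan.

(** * The product of [Q] with square roots of [P] on both sides, and its Ky Fan sums *)

Section Sandwich.
Context {R : realType}.
Local Notation C := R[i].
Local Notation "x %:C" := (real_complex R x) (format "x %:C") : ring_scope.

Definition sandwich l (P Q : 'M[C]_l) : 'M[C]_l := mxsqrt P *m Q *m mxsqrt P.

Lemma mxsqrt_posdef l (P : 'M[C]_l) : posdef P -> posdef (mxsqrt P).
Proof. by move=> P0; rewrite (mxsqrtE P0); apply: mxpow_posdef. Qed.

Lemma mxsqrtK l (P : 'M[C]_l) : posdef P -> mxsqrt P *m mxsqrt P = P.
Proof.
move=> P0; rewrite (mxsqrtE P0) -(mxpowD _ _ P0) -[RHS](mxpow1 P0).
by congr (mxpow _ _); field.
Qed.

Lemma invmx_square l (L P : 'M[C]_l) : L \in unitmx -> L *m L = P ->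
  invmx P = invmx L *m invmx L.
Proof.
move=> Lu <-; have LLu : L *m L \in unitmx by rewrite unitmx_mul Lu.
rewrite -[RHS](mulKmx LLu).
have -> : L *m L *m (invmx L *m invmx L) = 1%:M.
  by rewrite -mulmxA (mulmxA L (invmx L)) (mulmxV Lu) mul1mx (mulmxV Lu).
by rewrite mulmx1.
Qed.

Lemma mxsqrt_invK l (P : 'M[C]_l) : posdef P -> mxsqrt P *m invmx P *m mxsqrt P = 1%:M.
Proof.
move=> P0; have := posdef_unit (mxsqrt_posdef P0); have := mxsqrtK P0.
move: (mxsqrt P) => L LL Lu; rewrite (invmx_square Lu LL).
by rewrite mulmxA (mulmxV Lu) mul1mx (mulVmx Lu).
Qed.

Lemma sandwich_posdef l (P Q : 'M[C]_l) : posdef P -> posdef Q -> posdef (sandwich P Q).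
Proof.
move=> P0 Q0; have L0 := mxsqrt_posdef P0; rewrite /sandwich -{1}L0.1.
exact: posdef_congr Q0 (unitmx_inj (posdef_unit L0)).
Qed.

(** The substitution [Z = P ^ (1 / 2) *m V] decouples the matrices: [V^* V] becomes [Z^* P^-1 Z],
    and compressing the sandwich by [V] becomes compressing [Q] by [Z]. *)
Lemma kyfan_compress l k (P Q : 'M[C]_l) U (x y : 'I_l -> R) (Z : 'M[C]_(l, k))
    (E : 'M[C]_k) (e pen : 'I_k -> R) (s : R) : (k <= l)%N -> posdef P ->
  unitary U -> sandwich P Q = spec U (fun i => (x i)%:C) ->
  unitary E -> (forall b, 0 < e b) ->
  adjmx Z *m invmx P *m Z = spec E (fun b => (e b)%:C) ->
  (forall i j : 'I_l, (i <= j)%N -> y j <= y i) ->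
  (forall i b, s * (x i * e b) <= y i + pen b) ->
  s * complex.Re (\tr (adjmx Z *m Q *m Z)) <=
  \sum_(i < l | (i < k)%N) y i + \sum_b pen b.
Proof.
move=> kl P0 UU XE EE e0 ZE ys yp.
have L0 := mxsqrt_posdef P0; have Lu := posdef_unit L0; have LL := mxsqrtK P0.
have Ih : adjmx (invmx (mxsqrt P)) = invmx (mxsqrt P) := (posdef_inv L0).1.
move: XE; rewrite /sandwich; move: (mxsqrt P) Lu LL Ih {L0} => L Lu LL Ih XE.
pose V := invmx L *m Z.
have VV : adjmx V *m V = spec E (fun b => (e b)%:C).
  by rewrite -ZE /V adjmxM Ih (invmx_square Lu LL) !mulmxA.
have -> : adjmx Z *m Q *m Z = adjmx V *m spec U (fun i => (x i)%:C) *m V.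
  have VL : adjmx V *m L = adjmx Z by rewrite /V adjmxM Ih -mulmxA (mulVmx Lu) mulmx1.
  have LV : L *m V = Z by rewrite /V (mulKVmx Lu).
  by rewrite -XE !mulmxA VL -!mulmxA LV.
exact: kyfan_bound kl UU EE e0 VV ys yp.
Qed.

(** [Z] is [P ^ (1 / 2)] applied to the first [k] eigenvectors of the sandwich, scaled by
    [sqrt (d b)]. The weights [d] are left free for the optimal choice in each application. *)
Lemma kyfan_attain l k (P Q : 'M[C]_l) U (x : 'I_l -> R) (d : 'I_k -> R) (kl : (k <= l)%N) :
  posdef P -> unitary U -> sandwich P Q = spec U (fun i => (x i)%:C) ->
  (forall b, 0 < d b) ->
  exists Z : 'M[C]_(l, k), [/\ forall v : 'cV_k, Z *m v = 0 -> v = 0,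
    adjmx Z *m invmx P *m Z = spec 1%:M (fun b => (d b)%:C)
  & complex.Re (\tr (adjmx Z *m Q *m Z)) = \sum_b d b * x (widen_ord kl b)].
Proof.
move=> P0 UU XE d0; have L0 := mxsqrt_posdef P0; have LPL := mxsqrt_invK P0.
have Lh : adjmx (mxsqrt P) = mxsqrt P := L0.1.
have I0 := posdef_inv P0.
move: XE; rewrite /sandwich; move: (mxsqrt P) LPL Lh {L0} => L LPL Lh XE.
pose J : 'M[C]_(l, k) :=
  \matrix_(i, b) ((Num.sqrt (d b))%:C *+ (i == widen_ord kl b)).
have JE (h : 'I_l -> C) a b : \sum_i (adjmx J a i * h i) * J i b =
    (d b)%:C * h (widen_ord kl b) *+ (a == b).
  rewrite (bigD1 (widen_ord kl b))//= big1 => [|i ib]; last first.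
    by rewrite [J i b]mxE (negbTE ib) mulr0n mulr0.
  rewrite adjmx_entry ![J _ _]mxE eqxx addr0 mulr1n.
  have -> : (widen_ord kl b == widen_ord kl a) = (a == b).
    by rewrite eq_sym -(inj_eq val_inj).
  have [->|_] := eqVneq a b; last by rewrite !mulr0n conjC0 !mul0r.
  rewrite !mulr1n conjC_real mulrAC -rmorphM -expr2 sqr_sqrtr ?ltW//.
have adjZ : adjmx (L *m adjmx U *m J) = adjmx J *m U *m L.
  by rewrite !adjmxM adjmxK Lh mulmxA.
have spec1 (h : 'I_k -> C) : spec 1%:M h = diag_mx (\row_b h b).
  have -> : spec 1%:M h = adjmx 1%:M *m diag_mx (\row_b h b) *m 1%:M by [].
  by rewrite adjmx1 mul1mx mulmx1.
have ZPZ : adjmx (L *m adjmx U *m J) *m invmx P *m (L *m adjmx U *m J) =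
    spec 1%:M (fun b => (d b)%:C).
  have -> : adjmx (L *m adjmx U *m J) *m invmx P *m (L *m adjmx U *m J) = adjmx J *m J.
    rewrite adjZ !mulmxA -(mulmxA _ L (invmx P)) -(mulmxA _ (L *m invmx P) L) LPL mulmx1.
    by rewrite -(mulmxA _ U) UU mulmx1.
  rewrite spec1; apply/matrixP => a b; have := JE (fun=> 1) a b; rewrite mulr1 => H.
  rewrite [LHS]mxE [RHS]mxE [(\row_ _ _) _ _]mxE.
  have -> : (d a)%:C *+ (a == b) = (d b)%:C *+ (a == b) by case: eqP => [->|].
  by rewrite -H; apply: eq_bigr => i _; rewrite mulr1.
exists (L *m adjmx U *m J); split=> //.
- move=> v Zv; apply/eqP; apply: contraT => v0.
  have U1 : unitary (1%:M : 'M[C]_k) by rewrite /unitary adjmx1 mulmx1.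
  have [_ /(_ v v0)] := spec_posdef U1 d0.
  by rewrite -/(qf _ v) -ZPZ qf_conj Zv /qf mulmx0 mxE ltxx.
- have -> : adjmx (L *m adjmx U *m J) *m Q *m (L *m adjmx U *m J) =
     adjmx J *m diag_mx (\row_i (x i)%:C) *m J.
    have XE' : L *m Q *m L = adjmx U *m diag_mx (\row_i (x i)%:C) *m U by rewrite XE.
    rewrite adjZ !mulmxA -(mulmxA _ L Q) -(mulmxA _ (L *m Q) L) XE'.
    rewrite !mulmxA -(mulmxA _ U (adjmx U)) UU mulmx1.
    by rewrite -(mulmxA _ U (adjmx U)) UU mulmx1.
  rewrite /mxtrace cRe_sum; apply: eq_bigr => b _.
  have := JE (fun i => (x i)%:C) b b; rewrite eqxx mulr1n -rmorphM => H.
  rewrite mul_mx_diag [_ b b]mxE.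
  have -> : \sum_j (\matrix_(i, j0) (adjmx J i j0 * (\row_i0 (x i0)%:C) 0 j0)) b j * J j b =
     (d b * x (widen_ord kl b))%:C; last by [].
  by rewrite -H; apply: eq_bigr => i _; rewrite [(\matrix_(_, _) _) b i]mxE [(\row_ _ _) _ _]mxE.
Qed.

End Sandwich.

(** * Convexity of Ky Fan sums and of trace functions of the sandwich *)

Section SandwichConvexity.
Context {R : realType}.
Local Notation C := R[i].
Local Notation "x %:C" := (real_complex R x) (format "x %:C") : ring_scope.

Lemma tr_compress l k (Q : 'M[C]_l) (Z : 'M[C]_(l, k)) :
  \tr (adjmx Z *m Q *m Z) = \sum_b qf Q (col b Z).
Proof.
apply: eq_bigr => b _; rewrite /qf.
have -> : adjmx (col b Z) = row b (adjmx Z).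
  by apply/matrixP => i j; rewrite adjmx_entry !mxE.
rewrite -row_mul [LHS]mxE [RHS]mxE; apply: eq_bigr => j _.
by rewrite [row b _ _ _]mxE [col b Z _ _]mxE.
Qed.

Lemma tr_compress_convex l k (Q Q1 Q2 : 'M[C]_l) (Z : 'M[C]_(l, k)) (t : R) :
  (forall x, complex.Re (qf Q x) <=
     t * complex.Re (qf Q1 x) + (1 - t) * complex.Re (qf Q2 x)) ->
  complex.Re (\tr (adjmx Z *m Q *m Z)) <=
  t * complex.Re (\tr (adjmx Z *m Q1 *m Z)) +
  (1 - t) * complex.Re (\tr (adjmx Z *m Q2 *m Z)).
Proof.
move=> H; rewrite !tr_compress !cRe_sum !mulr_sumr -big_split/=.
by apply: ler_sum => b _; apply: H.
Qed.

(** [tau] stands for the traces with [Q], [rho] for the trace powers with [P^-1], and [S] for the Ky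
    Fan sums. At the optimal [Z] both traces equal [S], and [s * S - (s - 1) * S = S]. *)
Lemma kyfan_scalar (s t S S1 S2 tau tau1 tau2 rho rho1 rho2 : R) :
  0 <= t <= 1 -> 1 <= s -> tau = S -> rho = S ->
  tau <= t * tau1 + (1 - t) * tau2 ->
  t * rho1 + (1 - t) * rho2 <= rho ->
  s * tau1 <= S1 + (s - 1) * rho1 -> s * tau2 <= S2 + (s - 1) * rho2 ->
  S <= t * S1 + (1 - t) * S2.
Proof.
case/andP=> t0 t1 s1 Et Er H1 H2 H3 H4; rewrite -subr_ge0 in t1.
have s0 : 0 <= s by lra.
have s10 : 0 <= s - 1 by lra.
have := ler_wpM2l t0 H3; have := ler_wpM2l t1 H4.
have := ler_wpM2l s0 H1; have := ler_wpM2l s10 H2; rewrite Er Et; lra.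
Qed.

Lemma kyfan_powR_bound l k (P Q : 'M[C]_l) U (x : 'I_l -> R) (Z : 'M[C]_(l, k)) (c : R) :
  0 < c < 1 -> (k <= l)%N -> posdef P -> unitary U -> (forall i, 0 < x i) ->
  (forall i j : 'I_l, (i <= j)%N -> x j <= x i) ->
  sandwich P Q = spec U (fun i => (x i)%:C) ->
  (forall v : 'cV_k, Z *m v = 0 -> v = 0) ->
  (1 - c)^-1 * complex.Re (\tr (adjmx Z *m Q *m Z)) <=
  \sum_(i < l | (i < k)%N) x i `^ (1 - c)^-1 +
  ((1 - c)^-1 - 1) * complex.Re (\tr (mxpow (adjmx Z *m invmx P *m Z) c^-1)).
Proof.
move=> cI kl P0 UU x0 xs XE Zi.
have [E [e [EE e0 ZE]]] := posdef_spec (posdef_congr (posdef_inv P0) Zi).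
have s0 : 0 <= (1 - c)^-1 by rewrite invr_ge0 subr_ge0; case/andP: cI => _ /ltW.
have -> : ((1 - c)^-1 - 1) * complex.Re (\tr (mxpow (adjmx Z *m invmx P *m Z) c^-1)) =
    \sum_b ((1 - c)^-1 - 1) * e b `^ c^-1.
  by rewrite ZE (mxpow_spec _ _ EE) (spec_tr _ EE) cRe_sum -mulr_sumr.
refine (kyfan_compress kl P0 UU XE EE e0 ZE _ _).
- by move=> i j ij; rewrite ge0_ler_powR ?nnegrE ?(ltW (x0 _))// xs.
- by move=> i b; apply: young_top.
Qed.

Lemma kyfan_powR_convex l (P P1 P2 Q Q1 Q2 : 'M[C]_l) U U1 U2 (x x1 x2 : 'I_l -> R) (c t : R) :
  0 < c < 1 -> 0 <= t <= 1 -> posdef P -> posdef P1 -> posdef P2 ->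
  unitary U -> unitary U1 -> unitary U2 ->
  (forall i, 0 < x i) -> (forall i, 0 < x1 i) -> (forall i, 0 < x2 i) ->
  (forall i j : 'I_l, (i <= j)%N -> x1 j <= x1 i) ->
  (forall i j : 'I_l, (i <= j)%N -> x2 j <= x2 i) ->
  sandwich P Q = spec U (fun i => (x i)%:C) ->
  sandwich P1 Q1 = spec U1 (fun i => (x1 i)%:C) ->
  sandwich P2 Q2 = spec U2 (fun i => (x2 i)%:C) ->
  (forall v, complex.Re (qf Q v) <=
     t * complex.Re (qf Q1 v) + (1 - t) * complex.Re (qf Q2 v)) ->
  (forall k (Z : 'M[C]_(l, k)), (forall v : 'cV_k, Z *m v = 0 -> v = 0) ->
     t * complex.Re (\tr (mxpow (adjmx Z *m invmx P1 *m Z) c^-1)) +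
     (1 - t) * complex.Re (\tr (mxpow (adjmx Z *m invmx P2 *m Z) c^-1)) <=
     complex.Re (\tr (mxpow (adjmx Z *m invmx P *m Z) c^-1))) ->
  forall k, (k <= l)%N -> \sum_(i < l | (i < k)%N) x i `^ (1 - c)^-1 <=
     t * \sum_(i < l | (i < k)%N) x1 i `^ (1 - c)^-1 +
     (1 - t) * \sum_(i < l | (i < k)%N) x2 i `^ (1 - c)^-1.
Proof.
move=> cI tI P0 P10 P20 UU UU1 UU2 x0 x10 x20 xs1 xs2 XE XE1 XE2 HQ HW k kl.
have [c0 c1] : 0 < c /\ 0 < 1 - c by case/andP: cI => ? ?; split; rewrite ?subr_gt0.
have s1 : 1 <= (1 - c)^-1 by rewrite invf_ge1// gerBl ltW.
(* With [s = 1 / (1 - c)] one has [s - 1 = c * s], so [d * x = x ^ s] and [d ^ (1 / c) = x ^ s]: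
   this is the equality case of Young's inequality. The resulting [Z] is a trial matrix at both
   endpoints. *)
pose d (b : 'I_k) := x (widen_ord kl b) `^ ((1 - c)^-1 - 1).
have d0 b : 0 < d b by rewrite powR_gt0.
have [Z [Zi ZP ZQ]] := kyfan_attain kl P0 UU XE d0.
have SE : \sum_(i < l | (i < k)%N) x i `^ (1 - c)^-1 =
    \sum_(b < k) x (widen_ord kl b) `^ (1 - c)^-1 by rewrite big_ord_narrow.
have B1 := kyfan_powR_bound cI kl P10 UU1 x10 xs1 XE1 Zi.
have B2 := kyfan_powR_bound cI kl P20 UU2 x20 xs2 XE2 Zi.
refine (kyfan_scalar tI s1 _ _ (tr_compress_convex Z HQ) (HW _ _ Zi) B1 B2).
- rewrite SE ZQ; apply: eq_bigr => b _; rewrite /d mulrC.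
  by rewrite mulr_powRB1// ?invr_gt0// ltW.
- have U1' : unitary (1%:M : 'M[C]_k) by rewrite /unitary adjmx1 mulmx1.
  rewrite SE ZP (mxpow_spec _ _ U1') (spec_tr _ U1') cRe_sum; apply: eq_bigr => b _ /=.
  rewrite /d -powRrM; congr (_ `^ _); field.
  by rewrite !gt_eqF.
Qed.

(** The counterpart for [c = 0], where [P] is fixed: all weights are 1, there is no penalty, and
    only the convexity of [Q] matters. *)
Lemma kyfan_linear_convex l (P Q Q1 Q2 : 'M[C]_l) U U1 U2 (x x1 x2 : 'I_l -> R) (t : R) :
  posdef P -> unitary U -> unitary U1 -> unitary U2 -> 0 <= t <= 1 ->
  (forall i j : 'I_l, (i <= j)%N -> x1 j <= x1 i) ->
  (forall i j : 'I_l, (i <= j)%N -> x2 j <= x2 i) ->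
  sandwich P Q = spec U (fun i => (x i)%:C) ->
  sandwich P Q1 = spec U1 (fun i => (x1 i)%:C) ->
  sandwich P Q2 = spec U2 (fun i => (x2 i)%:C) ->
  (forall v, complex.Re (qf Q v) <=
     t * complex.Re (qf Q1 v) + (1 - t) * complex.Re (qf Q2 v)) ->
  forall k, (k <= l)%N -> \sum_(i < l | (i < k)%N) x i <=
     t * \sum_(i < l | (i < k)%N) x1 i + (1 - t) * \sum_(i < l | (i < k)%N) x2 i.
Proof.
move=> P0 UU UU1 UU2 /andP[t0 t1] xs1 xs2 XE XE1 XE2 HQ k kl; rewrite -subr_ge0 in t1.
have [Z [_ ZP ZQ]] := kyfan_attain kl P0 UU XE (fun=> ltr01).
have U1' : unitary (1%:M : 'M[C]_k) by rewrite /unitary adjmx1 mulmx1.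
have B (Q' : 'M[C]_l) U' (x' : 'I_l -> R) : unitary U' ->
    (forall i j : 'I_l, (i <= j)%N -> x' j <= x' i) ->
    sandwich P Q' = spec U' (fun i => (x' i)%:C) ->
    complex.Re (\tr (adjmx Z *m Q' *m Z)) <= \sum_(i < l | (i < k)%N) x' i.
  move=> UU' xs' XE'.
  have H i (b : 'I_k) : 1 * (x' i * (fun=> 1) b) <= x' i + (fun=> 0) b.
    by rewrite /= mul1r mulr1 addr0.
  have := kyfan_compress kl P0 UU' XE' U1' (fun=> ltr01) ZP xs' H.
  by rewrite mul1r [X in _ + X]big1 ?addr0.
have -> : \sum_(i < l | (i < k)%N) x i = complex.Re (\tr (adjmx Z *m Q *m Z)).
  by rewrite ZQ big_ord_narrow; apply: eq_bigr => b _; rewrite mul1r.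
refine (le_trans (tr_compress_convex Z HQ) _).
exact: lerD (ler_wpM2l t0 (B _ _ _ UU1 xs1 XE1)) (ler_wpM2l t1 (B _ _ _ UU2 xs2 XE2)).
Qed.

(** The common core of all three claims, with the two matrix variables hidden in [P] and [Q]. The
    hypothesis on [P] is split because [c^-1] has no meaning for [c = 0]. *)
Theorem tr_mxfun_sandwich_convex l (P P1 P2 Q Q1 Q2 : 'M[C]_l) (f : R -> R) (c t : R) :
  0 <= c < 1 -> 0 <= t <= 1 ->
  nondecreasing_pos f -> convex_pos (fun x => f (x `^ (1 - c))) ->
  posdef P -> posdef P1 -> posdef P2 -> posdef Q -> posdef Q1 -> posdef Q2 ->
  (forall v, complex.Re (qf Q v) <=
     t * complex.Re (qf Q1 v) + (1 - t) * complex.Re (qf Q2 v)) ->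
  (c = 0 -> P1 = P /\ P2 = P) ->
  (0 < c -> forall k (Z : 'M[C]_(l, k)), (forall v : 'cV_k, Z *m v = 0 -> v = 0) ->
     t * complex.Re (\tr (mxpow (adjmx Z *m invmx P1 *m Z) c^-1)) +
     (1 - t) * complex.Re (\tr (mxpow (adjmx Z *m invmx P2 *m Z) c^-1)) <=
     complex.Re (\tr (mxpow (adjmx Z *m invmx P *m Z) c^-1))) ->
  complex.Re (\tr (mxfun f (sandwich P Q))) <=
  t * complex.Re (\tr (mxfun f (sandwich P1 Q1))) +
  (1 - t) * complex.Re (\tr (mxfun f (sandwich P2 Q2))).
Proof.
move=> /andP[c0 c1] tI fm fc P0 P10 P20 Q0 Q10 Q20 HQ HP HW.
have [U [x [UU x0 xs XE]]] := posdef_spec_sorted (sandwich_posdef P0 Q0).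
have [U1 [x1 [UU1 x10 xs1 XE1]]] := posdef_spec_sorted (sandwich_posdef P10 Q10).
have [U2 [x2 [UU2 x20 xs2 XE2]]] := posdef_spec_sorted (sandwich_posdef P20 Q20).
have c10 : 0 < 1 - c by rewrite subr_gt0.
(* Each eigenvalue [y] is rewritten as [(y ^ (1 / (1 - c))) ^ (1 - c)], so that the convex function
   of the hypothesis is evaluated at the powers whose Ky Fan sums are controlled. *)
have trE (X : 'M[C]_l) V (y : 'I_l -> R) : unitary V -> X = spec V (fun i => (y i)%:C) ->
    (forall i, 0 < y i) ->
    complex.Re (\tr (mxfun f X)) = \sum_i f ((y i `^ (1 - c)^-1) `^ (1 - c)).
  move=> VV -> y0; rewrite (mxfun_spec _ _ VV) (spec_tr _ VV) cRe_sum.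
  apply: eq_bigr => i _ /=; rewrite -powRrM mulVf ?gt_eqF// powRr1//; exact: ltW.
have le3 (a b1 b2 a' b1' b2' : R) : a = a' -> b1 = b1' -> b2 = b2' ->
  a' <= t * b1' + (1 - t) * b2' -> a <= t * b1 + (1 - t) * b2 by move=> -> -> ->.
apply: (le3 _ _ _ _ _ _ (trE _ _ _ UU XE x0) (trE _ _ _ UU1 XE1 x10) (trE _ _ _ UU2 XE2 x20)).
have K : forall k, (k <= l)%N -> \sum_(i < l | (i < k)%N) x i `^ (1 - c)^-1 <=
     t * \sum_(i < l | (i < k)%N) x1 i `^ (1 - c)^-1 +
     (1 - t) * \sum_(i < l | (i < k)%N) x2 i `^ (1 - c)^-1.
  move: c0; rewrite le_eqVlt => /predU1P[c0|c0]; last first.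
    have cI : 0 < c < 1 by rewrite c0.
    exact: (kyfan_powR_convex cI tI P0 P10 P20 UU UU1 UU2 x0 x10 x20 xs1 xs2 XE XE1 XE2 HQ (HW c0)).
  have [E1 E2] := HP (esym c0); rewrite E1 in XE1; rewrite E2 in XE2.
  have p1 (y : 'I_l -> R) (k : nat) : (forall i, 0 < y i) ->
      \sum_(i < l | (i < k)%N) y i `^ (1 - c)^-1 = \sum_(i < l | (i < k)%N) y i.
    move=> y0; apply: eq_bigr => i _; rewrite -c0 subr0 invr1 powRr1//; exact: ltW.
  move=> k kl; rewrite (p1 _ _ x0) (p1 _ _ x10) (p1 _ _ x20).
  exact: kyfan_linear_convex P0 UU UU1 UU2 tI xs1 xs2 XE XE1 XE2 HQ k kl.
have gm : nondecreasing_pos (fun y => f (y `^ (1 - c))).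
  move=> a b a0 ab; apply: fm; first exact: powR_gt0.
  by rewrite ge0_ler_powR ?nnegrE ?(ltW c10)//; [exact: ltW|exact: le_trans (ltW a0) ab].
have p0 (y : 'I_l -> R) : (forall i, 0 < y i) -> forall i, 0 < y i `^ (1 - c)^-1.
  by move=> y0 i; apply: powR_gt0.
refine (majorize_convex gm fc tI (p0 _ x0) (p0 _ x10) (p0 _ x20) _ K).
move=> i j ij; apply: ge0_ler_powR; first by rewrite invr_ge0; exact: ltW.
- by rewrite nnegrE; exact: ltW.
- by rewrite nnegrE; exact: ltW.
- exact: xs.
Qed.

End SandwichConvexity.

(** * Joint convexity *)

Section JointConvexity.
Context {R : realType}.
Local Notation C := R[i].
Local Notation "x %:C" := (real_complex R x) (format "x %:C") : ring_scope.

Lemma linear_posmap n k (P : {linear 'M[C]_n -> 'M[C]_k}) : strictly_positive P -> posmap P.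
Proof. by move=> HP; split=> // a X Y; rewrite linearP. Qed.

Lemma posmap_ge n k (P : 'M[C]_n -> 'M[C]_k) (t : R) (X X1 X2 : 'M[C]_n) : posmap P ->
  adjmx X = X -> adjmx X1 = X1 -> adjmx X2 = X2 ->
  (forall x, t * complex.Re (qf X1 x) + (1 - t) * complex.Re (qf X2 x) <=
     complex.Re (qf X x)) ->
  forall y, t * complex.Re (qf (P X1) y) + (1 - t) * complex.Re (qf (P X2) y) <=
     complex.Re (qf (P X) y).
Proof.
move=> HP Xh X1h X2h H y.
have Nh (Y : 'M[C]_n) : adjmx Y = Y -> adjmx (- Y) = - Y by move=> E; rewrite adjmxN E.
have PN (Y : 'M[C]_n) : P (- Y) = - P Y.
  have := posmap_sum [:: tt] (fun=> -1) (fun=> Y) HP.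
  by rewrite !big_seq1 !scaleN1r.
have qN m (Y : 'M[C]_m) v : complex.Re (qf (- Y) v) = - complex.Re (qf Y v).
  by rewrite -scaleN1r qfZ mulN1r; case: (qf Y v).
have neg (a b1 b2 : R) : - a <= t * - b1 + (1 - t) * - b2 -> t * b1 + (1 - t) * b2 <= a.
  by rewrite !mulrN -opprD lerN2.
apply: neg; rewrite -!qN -!PN.
apply: (posmap_le HP (Nh _ Xh) (Nh _ X1h) (Nh _ X2h)) => x; rewrite !qN.
by rewrite !mulrN -opprD lerN2; apply: H.
Qed.

(** The map [P] preserves operator concavity of the power [c], and inversion turns a concave
    denominator into a convex function. *)
Lemma posmap_inv_convex n k (P : 'M[C]_n -> 'M[C]_k) (c t : R) (B1 B2 : 'M[C]_n) x :
  posmap P -> 0 <= c <= 1 -> 0 <= t <= 1 -> posdef B1 -> posdef B2 ->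
  complex.Re (qf (invmx (P (mxpow (t%:C *: B1 + (1 - t)%:C *: B2) c))) x) <=
  t * complex.Re (qf (invmx (P (mxpow B1 c))) x) +
  (1 - t) * complex.Re (qf (invmx (P (mxpow B2 c))) x).
Proof.
move=> HP cI tI B10 B20; have B0 := posdef_convex tI B10 B20.
have E (M : 'M[C]_k) : invmx M = adjmx 1%:M *m invmx M *m 1%:M.
  by rewrite adjmx1 mul1mx mulmx1.
apply: (qf_convex_eq (E _) (E _) (E _)).
have Pp := HP.2; have M0 := mxpow_posdef c B0.
have M10 := mxpow_posdef c B10; have M20 := mxpow_posdef c B20.
refine (quad_over_lin_convex x tI (Pp _ M0) (Pp _ M10) (Pp _ M20) _
  (posmap_ge HP M0.1 M10.1 M20.1 (fun v => mxpow_opconcave v cI tI B10 B20))).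
by rewrite -scalerDl -rmorphD/= addrC subrK scale1r.
Qed.

(** This brings [F2] to the shape of [F1], with [P] and [Q] replaced by their inverses. *)
Lemma invmx_sandwich l (P Q : 'M[C]_l) : posdef P -> posdef Q ->
  invmx (sandwich P Q) = sandwich (invmx P) (invmx Q).
Proof.
move=> P0 Q0; have I0 := posdef_inv P0.
have LE : mxsqrt (invmx P) = invmx (mxsqrt P).
  have IE : invmx P = mxpow P (- 1) by rewrite (mxpowN _ P0) (mxpow1 P0).
  apply: etrans (mxsqrtE I0) _.
  apply: etrans (congr1 (fun X => mxpow X 2^-1) IE) _.
  apply: etrans (mxpowM _ _ P0) _; rewrite mulN1r.
  exact: etrans (mxpowN _ P0) (congr1 invmx (esym (mxsqrtE P0))).
rewrite /sandwich LE.
have := posdef_unit (mxsqrt_posdef P0); move: (mxsqrt P) => L Lu {LE I0 P0}.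
have Qu := posdef_unit Q0; have Xu : L *m Q *m L \in unitmx by rewrite !unitmx_mul Lu Qu.
rewrite -[RHS](mulKmx Xu).
have -> : L *m Q *m L *m (invmx L *m invmx Q *m invmx L) = 1%:M.
  rewrite !mulmxA -(mulmxA _ L (invmx L)) (mulmxV Lu) mulmx1.
  by rewrite -(mulmxA _ Q (invmx Q)) (mulmxV Qu) mulmx1 (mulmxV Lu).
by rewrite mulmx1.
Qed.

Lemma posmap_congr n l k (P : 'M[C]_n -> 'M[C]_l) (Z : 'M[C]_(l, k)) :
  posmap P -> (forall v : 'cV_k, Z *m v = 0 -> v = 0) ->
  posmap (fun X => adjmx Z *m P X *m Z).
Proof.
move=> [Pl Pp] Zi; split.
  by move=> a X Y; rewrite Pl mulmxDr mulmxDl -scalemxAr -scalemxAl.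
by move=> X X0; apply: posdef_congr Zi; apply: Pp.
Qed.

Lemma F1_convex n m l (Phi : 'M[C]_n -> 'M[C]_l) (Psi : 'M[C]_m -> 'M[C]_l)
    (f : R -> R) (p q : R) : posmap Phi -> posmap Psi ->
  nondecreasing_pos f -> -1 < p <= 0 -> convex_pos (fun x => f (x `^ (1 + p))) ->
  -1 <= q <= 0 \/ 1 <= q <= 2 -> jointly_convex (F1 Phi Psi f p q).
Proof.
move=> HPhi HPsi fm /andP[p1 p0] fc qI A1 A2 B1 B2 t A10 A20 B10 B20 tI.
have A0 := posdef_convex tI A10 A20; have B0 := posdef_convex tI B10 B20.
have pd (X : 'M[C]_n) : posdef X -> posdef (Phi (mxpow X p)).
  by move=> X0; apply: HPhi.2; apply: mxpow_posdef.
have qd (X : 'M[C]_m) : posdef X -> posdef (Psi (mxpow X q)).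
  by move=> X0; apply: HPsi.2; apply: mxpow_posdef.
have cI : 0 <= - p < 1 by rewrite oppr_ge0 p0 ltrNl.
have fc' : convex_pos (fun x => f (x `^ (1 - - p))) by rewrite opprK.
have HQ v : complex.Re (qf (Psi (mxpow (t%:C *: B1 + (1 - t)%:C *: B2) q)) v) <=
    t * complex.Re (qf (Psi (mxpow B1 q)) v) + (1 - t) * complex.Re (qf (Psi (mxpow B2 q)) v).
  apply: (posmap_le HPsi (mxpow_posdef q B0).1 (mxpow_posdef q B10).1 (mxpow_posdef q B20).1).
  by move=> x; case: qI => qI; [exact: mxpow_opconvex_neg|exact: mxpow_opconvex_12].
refine (tr_mxfun_sandwich_convex cI tI fm fc' (pd _ A0) (pd _ A10) (pd _ A20)
  (qd _ B0) (qd _ B10) (qd _ B20) HQ _ _).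
(* For [p = 0] every [A] has power 1, so the left factor is the constant [Phi 1]. *)
- move=> /eqP; rewrite oppr_eq0 => /eqP ->.
  by rewrite (mxpow0 A0) (mxpow0 A10) (mxpow0 A20).
- move=> c0 k Z Zi; have cI' : 0 < - p < 1 by rewrite c0; case/andP: cI.
  by have := tr_inv_powR_concave HPhi Zi cI' tI A10 A20; rewrite opprK.
Qed.

(** The premise on [Psi] isolates what differs between the two claims about [F2]. Here [P] is
    [invmx (Phi (A ^ c))], so the concavity needed for [P^-1] is that of the trace power of a
    positive map, without Choi's inequality. *)
Lemma F2_convex n m l (Phi : 'M[C]_n -> 'M[C]_l) (Psi : 'M[C]_m -> 'M[C]_l)
    (f : R -> R) (p q : R) : posmap Phi -> posmap Psi ->
  nondecreasing_pos f -> -1 < p <= 0 -> convex_pos (fun x => f (x `^ (1 + p))) ->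
  (forall (t : R) B1 B2 x, 0 <= t <= 1 -> posdef B1 -> posdef B2 ->
    complex.Re (qf (invmx (Psi (mxpow (t%:C *: B1 + (1 - t)%:C *: B2) (- q)))) x) <=
    t * complex.Re (qf (invmx (Psi (mxpow B1 (- q)))) x) +
    (1 - t) * complex.Re (qf (invmx (Psi (mxpow B2 (- q)))) x)) ->
  jointly_convex (F2 Phi Psi f p q).
Proof.
move=> HPhi HPsi fm /andP[p1 p0] fc HQ A1 A2 B1 B2 t A10 A20 B10 B20 tI.
have A0 := posdef_convex tI A10 A20; have B0 := posdef_convex tI B10 B20.
have pd (X : 'M[C]_n) : posdef X -> posdef (Phi (mxpow X (- p))).
  by move=> X0; apply: HPhi.2; apply: mxpow_posdef.
have qd (X : 'M[C]_m) : posdef X -> posdef (Psi (mxpow X (- q))).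
  by move=> X0; apply: HPsi.2; apply: mxpow_posdef.
have cI : 0 <= - p < 1 by rewrite oppr_ge0 p0 ltrNl.
have fc' : convex_pos (fun x => f (x `^ (1 - - p))) by rewrite opprK.
have FE A B : posdef A -> posdef B -> F2 Phi Psi f p q A B =
    complex.Re (\tr (mxfun f (sandwich (invmx (Phi (mxpow A (- p))))
                                       (invmx (Psi (mxpow B (- q))))))).
  by move=> HA HB; rewrite -(invmx_sandwich (pd _ HA) (qd _ HB)).
rewrite (FE _ _ A0 B0) (FE _ _ A10 B10) (FE _ _ A20 B20).
refine (tr_mxfun_sandwich_convex cI tI fm fc' (posdef_inv (pd _ A0)) (posdef_inv (pd _ A10))
  (posdef_inv (pd _ A20)) (posdef_inv (qd _ B0)) (posdef_inv (qd _ B10))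
  (posdef_inv (qd _ B20)) (fun v => HQ t B1 B2 v tI B10 B20) _ _).
- move=> ->.
  by rewrite (mxpow0 A0) (mxpow0 A10) (mxpow0 A20).
- move=> c0 k Z Zi; have cI' : 0 < - p < 1 by rewrite c0; case/andP: cI.
  pose g X := complex.Re (\tr (mxpow (adjmx Z *m X *m Z) (- p)^-1)).
  have gE X : g (invmx (invmx X)) = g X by rewrite invmxK.
  have le3 (a b1 b2 a' b1' b2' : R) : a = a' -> b1 = b1' -> b2 = b2' ->
    t * b1' + (1 - t) * b2' <= a' -> t * b1 + (1 - t) * b2 <= a by move=> -> -> ->.
  apply: (le3 _ _ _ _ _ _ (gE _) (gE _) (gE _)).
  exact: tr_powR_concave (posmap_congr HPhi Zi) cI' tI A10 A20.
Qed.

End JointConvexity.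

Theorem theorem5p3 (R : realType) (n m l : nat)
  (Phi : {linear 'M[R[i]]_n -> 'M[R[i]]_l})
  (Psi : {linear 'M[R[i]]_m -> 'M[R[i]]_l})
  (f : R -> R) (p : R) :
  strictly_positive Phi -> strictly_positive Psi ->
  nondecreasing_pos f ->
  -1 < p <= 0 ->
  convex_pos (fun x => f (x `^ (1 + p))) ->
  (forall q : R, (p, q) <> (0, 0) -> (-1 <= q <= 0 \/ 1 <= q <= 2) ->
     jointly_convex (F1 Phi Psi f p q)) /\
  (forall q : R, (p, q) <> (0, 0) -> -1 <= q <= 0 ->
     jointly_convex (F2 Phi Psi f p q)) /\
  (forall q : R, (p, q) <> (0, 0) -> 1 <= q <= 2 ->
     jointly_convex (F2 Phi (@idfun 'M[R[i]]_l) f p q)).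
Proof.
move=> /linear_posmap HPhi /linear_posmap HPsi fm pI fc; split; [|split].
- by move=> q _ qI; apply: F1_convex.
- move=> q _ qI; apply: F2_convex => // t B1 B2 x tI B10 B20.
  apply: posmap_inv_convex => //.
  by rewrite oppr_ge0 lerNl andbC.
(* For the identity map, the inverse of [B ^ (- q)] is [B ^ q] itself, so operator convexity on the
   exponents from 1 to 2 applies directly. *)
- move=> q _ qI; apply: F2_convex => //; first by split.
  move=> t B1 B2 x tI B10 B20; have B0 := posdef_convex tI B10 B20.
  have E (B : 'M[R[i]]_l) : posdef B -> invmx (idfun (mxpow B (- q))) = mxpow B q.
    by move=> HB; rewrite /= -(mxpowN _ HB) opprK.
  apply: (qf_convex_eq (E _ B0) (E _ B10) (E _ B20)).
  exact: mxpow_opconvex_12.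
Qed.
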